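(* Let $d,n$ be positive integers and let $\boldsymbol{\lambda}=(\boldsymbol{\lambda}^{(1)},\dots,\boldsymbol{\lambda}^{(d)})$ be a $d$-partition of $n$. Let the $d$-th roots of unity $\xi_1,\dots,\xi_d$ be ordered so that $\xi_1=1$. Then $V_{\boldsymbol{\lambda}}$ is an irreducible representation of $\mathbb{C}(q){\rm CTL}_{d,n}(q)$ (that is, the irreducible representation $V_{\boldsymbol{\lambda}}$ of $\mathbb{C}(q){\rm Y}_{d,n}(q)$ factors through the quotient $\mathbb{C}(q){\rm CTL}_{d,n}(q)$) if and only if the Young diagram of $\boldsymbol{\lambda}^{(1)}$ has at most two columns.
   Context: Let $q$ be an indeterminate. The Yokonuma--Hecke algebra ${\rm Y}_{d,n}(q)$ is the associative unital $\mathbb{C}[q,q^{-1}]$-algebra generated by $g_1,\dots,g_{n-1},t_1,\dots,t_n$ with relations: $g_ig_j=g_jg_i$ if $|i-j|>1$; $g_ig_{i+1}g_i=g_{i+1}g_ig_{i+1}$ for $1\le i\le n-2$; $t_it_j=t_jt_i$; $t_jg_i=g_it_{s_i(j)}$ where $s_i=(i,i+1)\in\mathfrak{S}_n$; $t_j^d=1$; and $g_i^2=q+(q-1)e_ig_i$, where $e_i=\frac1d\sum_{s=0}^{d-1}t_i^st_{i+1}^{-s}$. Complex Reflection Temperley--Lieb algebra: ${\rm CTL}_{d,n}(q)={\rm Y}_{d,n}(q)/\mathfrak{I}_{d,n}$, where $\mathfrak{I}_{d,n}$ is the two-sided ideal generated by $T_1e_1e_2\,g_{1,2}$ with $T_1=\frac1d\sum_{s=0}^{d-1}t_1^s$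 and $g_{1,2}=1+g_1+g_2+g_1g_2+g_2g_1+g_1g_2g_1$ (and $\mathfrak{I}_{d,n}=\{0\}$ if $n\le2$). Write $\mathbb{C}(q){\rm Y}_{d,n}(q)$ and $\mathbb{C}(q){\rm CTL}_{d,n}(q)$ for the algebras obtained by extension of scalars to $\mathbb{C}(q)$. A $d$-partition of $n$ is a $d$-tuple of (possibly empty) partitions whose sizes sum to $n$. A standard $d$-tableau $\mathcal{T}$ of shape $\boldsymbol{\lambda}$ is a bijective filling of the nodes of the Young diagrams of $\boldsymbol{\lambda}^{(1)},\dots,\boldsymbol{\lambda}^{(d)}$ by $1,\dots,n$ with entries increasing along rows and down columns in each diagram. If the number $i$ lies in row $x$ and column $y$ of the $k$-th diagram, put ${\rm p}_i={\rm p}(\mathcal{T}|i):=k$ and ${\rm c}_i={\rm c}(\mathcal{T}|i):=q^{y-x}$. For $\sigma\in\mathfrak{S}_n$, $\mathcal{T}^\sigma$ is obtained from $\mathcal{T}$ by applying $\sigma$ to the entries. Let $\{\xi_1,\dots,\xi_d\}$ be the set of all complex $d$-th roots of unity, with $\xi_1=1$. $V_{\boldsymbol{\lambda}}$ is the $\mathbb{C}(q)$-vector space with basis $\{\mathbf{v}_{\mathcal{T}}\}$ indexed by the standard $d$-tableaux of shape $\boldsymbol{\lambda}$ (with $\mathbf{v}_{\mathcal{T}}:=0$ for non-standard $\mathcal{T}$), with action $t_j(\mathbf{v}_{\mathcal{T}})=\xi_{{\rm p}_j}\mathbf{v}_{\mathcal{T}}$; and $g_i(\mathbf{v}_{\mathcal{T}})=\mathbf{v}_{\mathcal{T}^{s_i}}$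 if ${\rm p}_i>{\rm p}_{i+1}$; $g_i(\mathbf{v}_{\mathcal{T}})=q\,\mathbf{v}_{\mathcal{T}^{s_i}}$ if ${\rm p}_i<{\rm p}_{i+1}$; $g_i(\mathbf{v}_{\mathcal{T}})=\frac{q{\rm c}_{i+1}-{\rm c}_{i+1}}{{\rm c}_{i+1}-{\rm c}_i}\mathbf{v}_{\mathcal{T}}+\frac{q{\rm c}_{i+1}-{\rm c}_i}{{\rm c}_{i+1}-{\rm c}_i}\mathbf{v}_{\mathcal{T}^{s_i}}$ if ${\rm p}_i={\rm p}_{i+1}$. It is known that the $V_{\boldsymbol{\lambda}}$, for $\boldsymbol{\lambda}$ running over the $d$-partitions of $n$, form a complete set of pairwise non-isomorphic irreducible representations of $\mathbb{C}(q){\rm Y}_{d,n}(q)$. *)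

(* Defs.v *)
From HB Require Import structures.
From mathcomp Require Import all_boot all_order all_algebra all_fingroup.
From mathcomp Require Import fraction generic_quotient boolp reals complex.
From mathcomp Require Import monalg.

Set Implicit Arguments.
Unset Strict Implicit.
Unset Printing Implicit Defensive.

Import GRing.Theory.
Local Open Scope ring_scope.
Local Open Scope quotient_scope.

(* Associative unital algebras over a commutative ring, given by a central    *)
(* structure map.  MathComp's [algType] demands 1 != 0, which is not known a  *)
(* priori for an algebra presented by generators and relations.               *)

HB.mixin Record isAlgebraOver (A : comNzRingType) B of GRing.PzRing B := {
  scal : A -> B;
  scal1 : scal 1 = 1;
  scalD : forall a b, scal (a + b) = scal a + scal b;
  scalM : forall a b, scal (a * b) = scal a * scal b;
  scalC : forall a x, scal a * x = x * scal a
}.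

#[short(type="algOverType")]
HB.structure Definition AlgebraOver (A : comNzRingType) :=
  { B of GRing.PzRing B & isAlgebraOver A B }.

Arguments scal {A s}.

Definition freealg (A : comNzRingType) (X : choiceType) : Type :=
  {malg A[{fmonom X}]}.

Section FreeAlgebra.
Variables (A : comNzRingType) (X : choiceType).

HB.instance Definition _ := GRing.NzRing.on (freealg A X).

Definition fvar (x : X) : freealg A X := << 1 *g fmu x >>.
Definition fscal (a : A) : freealg A X := a%:MP.

Fact fscalC a x : fscal a * x = x * fscal a.
Proof.
rewrite /fscal [in LHS](monalgE x) [in RHS](monalgE x) mulr_sumr mulr_suml.
apply: eq_bigr => k _; rewrite !malgM_def !fgmulUU.
by rewrite mulm1 mul1m mulrC.
Qed.

HB.instance Definition _ := isAlgebraOver.Build A (freealg A X)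
  (rmorph1 (@malgC {fmonom X} A)) (raddfD (@malgC {fmonom X} A))
  (rmorphM (@malgC {fmonom X} A)) fscalC.
End FreeAlgebra.
Arguments fvar {A X}.

Section Quotient.
Variables (A : comNzRingType) (B : algOverType A) (S : B -> Prop).

Inductive ideal_gen : B -> Prop :=
| ideal_mem x : S x -> ideal_gen x
| ideal_0 : ideal_gen 0
| ideal_D x y : ideal_gen x -> ideal_gen y -> ideal_gen (x + y)
| ideal_Ml z x : ideal_gen x -> ideal_gen (z * x)
| ideal_Mr z x : ideal_gen x -> ideal_gen (x * z).

Definition ideal_eq (x y : B) : bool := `[< ideal_gen (x - y) >].

Fact ideal_N x : ideal_gen x -> ideal_gen (- x).
Proof. by rewrite -mulN1r; apply: ideal_Ml. Qed.

Fact ideal_eq_refl : reflexive ideal_eq.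
Proof. by move=> x; apply/asboolP; rewrite subrr; apply: ideal_0. Qed.

Fact ideal_eq_sym : symmetric ideal_eq.
Proof.
by move=> x y; apply/asboolP/asboolP => /ideal_N; rewrite opprB.
Qed.

Fact ideal_eq_trans : transitive ideal_eq.
Proof.
move=> y x z /asboolP xy /asboolP yz; apply/asboolP.
by rewrite -(subrK y x) -addrA; apply: ideal_D.
Qed.

Canonical ideal_equiv :=
  EquivRel ideal_eq ideal_eq_refl ideal_eq_sym ideal_eq_trans.

Definition quotalg : Type := {eq_quot ideal_equiv}.
HB.instance Definition _ := Choice.on quotalg.
HB.instance Definition _ := EqQuotient.on quotalg.

Definition qproj (x : B) : quotalg := \pi x.

Fact qprojP x y : qproj x = qproj y <-> ideal_gen (x - y).
Proof. by split=> [/eqmodP/asboolP|h]; last apply/eqmodP/asboolP. Qed.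

Fact qprojK u : qproj (repr u) = u. Proof. exact: reprK. Qed.

Definition qadd (u v : quotalg) := qproj (repr u + repr v).
Definition qopp (u : quotalg) := qproj (- repr u).
Definition qmul (u v : quotalg) := qproj (repr u * repr v).

Fact repr_qproj x : ideal_gen (repr (qproj x) - x).
Proof. by apply/qprojP; rewrite qprojK. Qed.

Fact qaddE x y : qadd (qproj x) (qproj y) = qproj (x + y).
Proof. by apply/qprojP; rewrite opprD addrACA; apply: ideal_D; apply: repr_qproj. Qed.

Fact qoppE x : qopp (qproj x) = qproj (- x).
Proof. by apply/qprojP; rewrite -opprD; apply/ideal_N/repr_qproj. Qed.

Fact qmulE x y : qmul (qproj x) (qproj y) = qproj (x * y).
Proof.
apply/qprojP; set x' := repr _; set y' := repr _.
have -> : x' * y' - x * y = x' * (y' - y) + (x' - x) * y.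
  by rewrite mulrBr mulrBl addrA subrK.
by apply: ideal_D; [apply: ideal_Ml | apply: ideal_Mr]; apply: repr_qproj.
Qed.

Fact qaddA : associative qadd.
Proof.
by move=> u v w; rewrite -(qprojK u) -(qprojK v) -(qprojK w) !qaddE addrA.
Qed.
Fact qaddC : commutative qadd.
Proof. by move=> u v; rewrite /qadd addrC. Qed.
Fact qadd0 : left_id (qproj 0) qadd.
Proof. by move=> u; rewrite -(qprojK u) qaddE add0r. Qed.
Fact qaddN : left_inverse (qproj 0) qopp qadd.
Proof. by move=> u; rewrite -(qprojK u) qoppE qaddE addNr. Qed.
HB.instance Definition _ :=
  GRing.isZmodule.Build quotalg qaddA qaddC qadd0 qaddN.

Fact qmulA : associative qmul.
Proof.
by move=> u v w; rewrite -(qprojK u) -(qprojK v) -(qprojK w) !qmulE mulrA.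
Qed.
Fact qmul1 : left_id (qproj 1) qmul.
Proof. by move=> u; rewrite -(qprojK u) qmulE mul1r. Qed.
Fact qmulr1 : right_id (qproj 1) qmul.
Proof. by move=> u; rewrite -(qprojK u) qmulE mulr1. Qed.
Fact qmulDl : left_distributive qmul qadd.
Proof.
move=> u v w; rewrite -(qprojK u) -(qprojK v) -(qprojK w).
by rewrite !(qaddE, qmulE) mulrDl.
Qed.
Fact qmulDr : right_distributive qmul qadd.
Proof.
move=> u v w; rewrite -(qprojK u) -(qprojK v) -(qprojK w).
by rewrite !(qaddE, qmulE) mulrDr.
Qed.
HB.instance Definition _ :=
  GRing.Zmodule_isPzRing.Build quotalg qmulA qmul1 qmulr1 qmulDl qmulDr.

Definition qscal (a : A) : quotalg := qproj (scal a).
Fact qscal1 : qscal 1 = 1. Proof. by rewrite /qscal scal1. Qed.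
Fact qscalD a b : qscal (a + b) = qscal a + qscal b.
Proof. by rewrite /qscal scalD -qaddE. Qed.
Fact qscalM a b : qscal (a * b) = qscal a * qscal b.
Proof. by rewrite /qscal scalM -qmulE. Qed.
Fact qscalC a u : qscal a * u = u * qscal a.
Proof.
rewrite -(qprojK u) /qscal.
by rewrite /GRing.mul /= !qmulE scalC.
Qed.
HB.instance Definition _ :=
  isAlgebraOver.Build A quotalg qscal1 qscalD qscalM qscalC.
End Quotient.

(* Extension of scalars of an A-algebra B along f : A -> K: the universal     *)
(* K-algebra receiving a ring morphism from B that restricts to f on scalars, *)
(* i.e. K \otimes_A B, with [ext_in b] standing for 1 \otimes b.              *)

Section ScalarExtension.
Variables (A K : comNzRingType) (f : {rmorphism A -> K}) (B : algOverType A).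

Inductive ext_rel : freealg K B -> Prop :=
| ext_rel1 : ext_rel (fvar 1 - 1)
| ext_relD x y : ext_rel (fvar (x + y) - (fvar x + fvar y))
| ext_relM x y : ext_rel (fvar (x * y) - fvar x * fvar y)
| ext_relZ a : ext_rel (fvar (scal a) - scal (f a)).

Definition scalar_ext : algOverType K := quotalg ext_rel.
Definition ext_in (b : B) : scalar_ext := qproj ext_rel (fvar b).
End ScalarExtension.

Record repr_of (K : fieldType) (B : algOverType K) (V : vectType K) := ReprOf {
  ract :> B -> 'End(V);
  ract1 : ract 1 = \1%VF;
  ractD : forall x y, ract (x + y) = ract x + ract y;
  ractM : forall x y, ract (x * y) = (ract x \o ract y)%VF;
  ractZ : forall a, ract (scal a) = a *: \1%VF
}.

Definition irreducible_repr (K : fieldType) (B : algOverType K)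
    (V : vectType K) (rho : repr_of B V) : Prop :=
  (fullv : {vspace V}) <> 0%VS /\
  forall W : {vspace V}, (forall x, (rho x @: W <= W)%VS) ->
    W = 0%VS \/ W = fullv.

Definition Cq (R : realType) : fieldType := {fraction {poly complex R}}.

Section Laurent.
Variable R : realType.
Local Notation C := (complex R).
Local Notation K := (Cq R).

Definition Cq_q : K := tofrac 'X.
Definition Cq_const (c : C) : K := tofrac c%:P.

Definition is_laurent : {pred K} :=
  fun x => `[< exists (p : {poly C}) (m : nat), x = tofrac p / Cq_q ^+ m >].

Fact Cq_q_neq0 : Cq_q != 0.
Proof. by rewrite tofrac_eq0 polyX_eq0. Qed.

Fact is_laurent_subring : subring_closed is_laurent.
Proof.
split=> [|x y|x y].
- by apply/asboolP; exists 1, 0; rewrite expr0 divr1 tofrac1.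
- move=> /asboolP[p [m ->]] /asboolP[r [k ->]]; apply/asboolP.
  exists (p * 'X ^+ k - r * 'X ^+ m), (m + k)%N.
  have nz j : Cq_q ^+ j != 0 by rewrite expf_neq0 ?Cq_q_neq0.
  rewrite tofracB !tofracM !tofracXn -/Cq_q exprD.
  by rewrite -mulNr addf_div // mulNr.
- move=> /asboolP[p [m ->]] /asboolP[r [k ->]]; apply/asboolP.
  by exists (p * r), (m + k)%N; rewrite tofracM exprD mulf_div.
Qed.

HB.instance Definition _ := GRing.isSubringClosed.Build K is_laurent
  is_laurent_subring.

Record laurent : predArgType := Laurent {
  laurent_val :> K; laurentP : laurent_val \in is_laurent }.
HB.instance Definition _ := [isSub for laurent_val].
HB.instance Definition _ := [Choice of laurent by <:].
HB.instance Definition _ := [SubChoice_isSubComNzRing of laurent by <:].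

Fact laurent_qP : Cq_q \in is_laurent.
Proof. by apply/asboolP; exists 'X, 0; rewrite expr0 divr1. Qed.
Definition laurent_q : laurent := Laurent laurent_qP.

Fact laurent_constP c : Cq_const c \in is_laurent.
Proof. by apply/asboolP; exists c%:P, 0; rewrite expr0 divr1. Qed.
Definition laurent_const (c : C) : laurent := Laurent (laurent_constP c).

Definition laurent_incl : {rmorphism laurent -> K} := \val.
End Laurent.

(* Indices.  Entries 1..n are encoded as 'I_n and the generators g_1..g_{n-1} *)
(* by 'I_n.-1, both shifted by one: [fst_ent i] and [snd_ent i] are the       *)
(* entries i and i+1 exchanged by s_i.                                        *)

Section Indices.
Variable n : nat.

Fact snd_ent_subproof (i : 'I_n.-1) : (i.+1 < n)%N.
Proof. by case: n i => [[]|m i] //=; apply: ltn_ord. Qed.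

Definition fst_ent (i : 'I_n.-1) : 'I_n := Ordinal (ltnW (snd_ent_subproof i)).
Definition snd_ent (i : 'I_n.-1) : 'I_n := Ordinal (snd_ent_subproof i).
Definition s_ (i : 'I_n.-1) : 'S_n := tperm (fst_ent i) (snd_ent i).
End Indices.

Section YokonumaHecke.
Variables (R : realType) (d n : nat).
Local Notation L := (laurent R).
Local Notation inv_d := (laurent_const (d%:R^-1 : complex R)).

Section Elements.
Variables (B : algOverType L) (t : 'I_n -> B) (g : 'I_n.-1 -> B).

(* As t_j ^+ d = 1, the power t_j ^- s is t_j ^+ (d - s) for s < d. *)
Definition e_ (i : 'I_n.-1) : B :=
  scal inv_d * \sum_(s < d) t (fst_ent i) ^+ s * t (snd_ent i) ^+ (d - s).

Definition T_ (j : 'I_n) : B := scal inv_d * \sum_(s < d) t j ^+ s.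

Definition g12_ (i j : 'I_n.-1) : B :=
  1 + g i + g j + g i * g j + g j * g i + g i * g j * g i.
End Elements.

Local Notation F := (freealg L ('I_n.-1 + 'I_n)%type).
Local Notation fg i := (fvar (inl i) : F).
Local Notation ft j := (fvar (inr j) : F).

Inductive YH_rel : F -> Prop :=
| YH_far (i j : 'I_n.-1) : (i.+1 < j)%N || (j.+1 < i)%N ->
    YH_rel (fg i * fg j - fg j * fg i)
| YH_braid (i j : 'I_n.-1) : j = i.+1 :> nat ->
    YH_rel (fg i * fg j * fg i - fg j * fg i * fg j)
| YH_tt (i j : 'I_n) : YH_rel (ft i * ft j - ft j * ft i)
| YH_tg (j : 'I_n) (i : 'I_n.-1) :
    YH_rel (ft j * fg i - fg i * ft (s_ i j))
| YH_td (j : 'I_n) : YH_rel (ft j ^+ d - 1)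
| YH_quad (i : 'I_n.-1) :
    YH_rel (fg i ^+ 2 - (scal (laurent_q R) +
              scal (laurent_q R - 1) * e_ (fun j => ft j) i * fg i)).

Definition YH : algOverType L := quotalg YH_rel.
Definition YH_g (i : 'I_n.-1) : YH := qproj YH_rel (fg i).
Definition YH_t (j : 'I_n) : YH := qproj YH_rel (ft j).

(* No generator, hence the zero ideal, when n <= 2. *)
Inductive CTL_rel : YH -> Prop :=
| CTL_gen (j : 'I_n) (i1 i2 : 'I_n.-1) :
    (j = 0 :> nat)%N -> (i1 = 0 :> nat)%N -> (i2 = 1 :> nat)%N ->
    CTL_rel (T_ YH_t j * e_ YH_t i1 * e_ YH_t i2 * g12_ YH_g i1 i2).

Definition CTL : algOverType L := quotalg CTL_rel.
Definition YH_to_CTL (x : YH) : CTL := qproj CTL_rel x.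

Definition CqYH : algOverType (Cq R) := scalar_ext (laurent_incl R) YH.
Definition CqCTL : algOverType (Cq R) := scalar_ext (laurent_incl R) CTL.
Definition YH_in (x : YH) : CqYH := ext_in (laurent_incl R) x.
Definition CTL_in (x : CTL) : CqCTL := ext_in (laurent_incl R) x.
End YokonumaHecke.

Definition is_partition (s : seq nat) : bool := sorted geq s && (0 \notin s)%N.

Definition is_dpartition (d n : nat) (lam : 'I_d -> seq nat) : Prop :=
  (forall k, is_partition (lam k)) /\ (\sum_(k < d) sumn (lam k) = n)%N.

Definition ncols (s : seq nat) : nat := \max_(r <- s) r.

(* A node (k, x, y) is the box in row x and column y (counted from 0) of the  *)
(* k-th diagram; rows and columns of a d-partition of n are bounded by n.     *)
Definition node (d n : nat) : finType := ('I_d * 'I_n * 'I_n)%type.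
Definition node_comp d n (u : node d n) : 'I_d := u.1.1.
Definition node_row d n (u : node d n) : 'I_n := u.1.2.
Definition node_col d n (u : node d n) : 'I_n := u.2.

(* A filling is recorded by the position of each entry. *)
Definition tableau (d n : nat) : finType := {ffun 'I_n -> node d n}.

Section Tableaux.
Variables (d n : nat) (lam : 'I_d -> seq nat).

Definition diagram : {set node d n} :=
  [set u | (node_col u < nth 0 (lam (node_comp u)) (node_row u))%N].

Definition is_standard (T : tableau d n) : bool :=
  [&& injectiveb T,
      [set T i | i : 'I_n] == diagram,
      [forall i : 'I_n, forall j : 'I_n,
         [&& node_comp (T i) == node_comp (T j),
             node_row (T i) == node_row (T j) &
             (node_col (T i) < node_col (T j))%N] ==> (i < j)%N] &
      [forall i : 'I_n, forall j : 'I_n,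
         [&& node_comp (T i) == node_comp (T j),
             node_col (T i) == node_col (T j) &
             (node_row (T i) < node_row (T j))%N] ==> (i < j)%N]].

Definition stdtab : finType := {T : tableau d n | is_standard T}.
End Tableaux.

(* T^sigma: the entry i of T is replaced by sigma i. *)
Definition permute_tab d n (T : tableau d n) (sigma : 'S_n) : tableau d n :=
  [ffun i => T ((sigma^-1)%g i)].

Section Seminormal.
Variables (R : realType) (d n : nat) (xi : 'I_d -> complex R).
Variable lam : 'I_d -> seq nat.
Local Notation K := (Cq R).
Local Notation q := (Cq_q R).

Definition Vlam : vectType K := {ffun stdtab n lam -> K^o}.

(* This is 0 when T is not standard of shape lam. *)
Definition v_ (T : tableau d n) : Vlam :=
  [ffun S : stdtab n lam => (val S == T)%:R : K].

Definition p_ (T : tableau d n) (i : 'I_n) : 'I_d := node_comp (T i).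

Definition c_ (T : tableau d n) (i : 'I_n) : K :=
  q ^ ((node_col (T i))%:Z - (node_row (T i))%:Z).

Definition t_action (j : 'I_n) (T : tableau d n) : Vlam :=
  Cq_const (xi (p_ T j)) *: v_ T.

Definition g_action (i : 'I_n.-1) (T : tableau d n) : Vlam :=
  let p  := p_ T (fst_ent i) in let p' := p_ T (snd_ent i) in
  let c  := c_ T (fst_ent i) in let c' := c_ T (snd_ent i) in
  let Ts := permute_tab T (s_ i) in
  if (p' < p)%N then v_ Ts
  else if (p < p')%N then q *: v_ Ts
  else ((q * c' - c') / (c' - c)) *: v_ T + ((q * c' - c) / (c' - c)) *: v_ Ts.

(* rho is the representation V_lambda of C(q)Y_{d,n}(q). *)
Definition is_Vlam (rho : repr_of (CqYH R d n) Vlam) : Prop :=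
  forall T : stdtab n lam,
    (forall j, rho (YH_in (YH_t R d j)) (v_ (val T)) = t_action j (val T)) /\
    (forall i, rho (YH_in (YH_g R d i)) (v_ (val T)) = g_action i (val T)).

(* rho is the pullback of tau along C(q)Y -> C(q)CTL; the elements 1 \otimes x *)
(* span C(q)Y over C(q).                                                      *)
Definition is_pullback (V : vectType K) (tau : repr_of (CqCTL R d n) V)
    (rho : repr_of (CqYH R d n) V) : Prop :=
  forall x : YH R d n, rho (YH_in x) = tau (CTL_in (YH_to_CTL x)).

(* V_lambda is (via the quotient map) an irreducible representation of        *)
(* C(q)CTL_{d,n}(q).                                                          *)
Definition Vlam_irreducible_CTL : Prop :=
  exists (rho : repr_of (CqYH R d n) Vlam) (tau : repr_of (CqCTL R d n) Vlam),
    [/\ is_Vlam rho, is_pullback tau rho & irreducible_repr tau].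
End Seminormal.

(* Main.v *)
(* V_lambda is built on the vectors v_T: on the label (component, content) of *)
(* the entries i and i+1, g_i acts by a "stay" and a "swap" coefficient.       *)
(* Setting the swap coefficient to 0 as soon as T or T^{s_i} is not standard   *)
(* reduces the Yokonuma-Hecke relations to rational identities in the two      *)
(* coefficients.  Irreducibility: the t_j and the Jucys-Murphy elements act    *)
(* diagonally with joint eigenvalues separating the standard tableaux, so an   *)
(* invariant subspace is spanned by some of the v_T, and standard tableaux are *)
(* connected by admissible swaps.                                              *)
(*   T_1 e_1 e_2 projects onto the span of the v_T with 1, 2, 3 all in the     *)
(* first component.  If that component has at most two columns, either 1 and 2 *)
(* are in one column and g_1 v_T = - v_T, or 1, 2, 3 fill a diagram of shape   *)
(* (2,1); in both cases g_{1,2} kills v_T.  With three columns, the tableau    *)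
(* read row by row has 1, 2, 3 in the first row, and g_{1,2} multiplies v_T by *)
(* (1 + q)(1 + q + q^2), which is not 0.                                       *)

From HB Require Import structures.
From mathcomp Require Import all_boot all_order all_algebra all_fingroup.
From mathcomp Require Import fraction generic_quotient reals complex monalg.
From mathcomp Require Import zify ring.
Require Import Defs.

Set Implicit Arguments.
Unset Strict Implicit.
Unset Printing Implicit Defensive.

Import GRing.Theory Num.Theory.

(** * Standard tableaux *)

(** The module [V_lambda] factors through the quotient exactly when the generator T_1 e_1 e_2
    g_{1,2} acts on it by zero. On a basis vector v_T the averages T_1, e_1, e_2 of powers of the
    t_j become averages of powers of roots of unity, so their product P is 1 or 0 according as 1, 2,
    3 all lie in the first component or not ([proj_endE]). This condition is symmetric in the three
    entries, so P commutes with g_1 and g_2, and the question is whether g_{1,2} kills each v_T with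
    1, 2, 3 in the first component ([proj_g12_end]).

    The element g_{1,2} is the symmetrizer of the Hecke algebra of the symmetric group on three
    letters, so only its index character survives, and that one occurs when 1, 2, 3 can be placed in
    a single row. Two columns leave no room for this ([symmetrizer_two_columns]). With three columns
    the row reading tableau achieves it, and g_{1,2} acts there by (1 + q)(1 + q + q^2), which is
    nonzero because q is not a root of unity ([symmetrizer_row]).

    The representation itself has to be built: the defining relations are checked on tableaux
    ([g_op_far], [g_op_braid], [g_op_quad]), where [std_content] keeps the denominators nonzero, and
    universal properties turn the operators into representations ([YH_lift], [CTL_lift],
    [scalar_ext_lift]). Irreducibility ([invariant_trivial]) rests on two facts about standard
    tableaux: components and contents determine them ([std_determined]), and admissible swaps
    connect them ([std_connected]). *)

Lemma partition_size_sumn (s : seq nat) : 0 \notin s -> size s <= sumn s.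
Proof.
elim: s => //= x s IHs; rewrite inE negb_or eq_sym => /andP[x0 /IHs].
by rewrite -lt0n in x0; lia.
Qed.

Lemma nth_sumn (s : seq nat) x : nth 0 s x <= sumn s.
Proof. by elim: s x => [|y s IHs] [|x] //=; [lia | have := IHs x; lia]. Qed.

Section StandardTableaux.
Variables (d n : nat) (lam : 'I_d -> seq nat).
Hypothesis lam_part : forall k, is_partition (lam k).
Implicit Types (T U : tableau d n) (u v : node d n) (i j : 'I_n).

Definition node_le u v :=
  [&& node_comp u == node_comp v, node_row u <= node_row v
    & node_col u <= node_col v].

(** The obstruction to exchanging two consecutive entries, see [std_swap]. *)
Definition aligned u v :=
  (node_comp u == node_comp v) &&
  ((node_row u == node_row v) || (node_col u == node_col v)).

Definition content u : int := ((node_col u)%:Z - (node_row u)%:Z)%R.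

Lemma node_eq u v : node_comp u = node_comp v ->
  node_row u = node_row v :> nat -> node_col u = node_col v :> nat -> u = v.
Proof.
case: u v => [[k x] y] [[k' x'] y'] /=; rewrite /node_comp /node_row /node_col /=.
by move=> -> /val_inj -> /val_inj ->.
Qed.

Lemma partition_nth_geq k x y : x <= y -> nth 0 (lam k) y <= nth 0 (lam k) x.
Proof.
move=> le_xy; have /andP[srt _] := lam_part k.
have [lt_y|ge_y] := ltnP y (size (lam k)); last by rewrite nth_default.
have geq_tr : transitive geq by move=> a b c /= h1 h2; apply: leq_trans h2 h1.
have := @sorted_leq_nth _ geq geq_tr leqnn 0 _ srt.
by apply=> //; rewrite inE //; apply: leq_ltn_trans lt_y.
Qed.

Lemma diagram_down u v : node_le u v ->
  v \in diagram n lam -> u \in diagram n lam.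
Proof.
case/and3P=> /eqP eq_k le_r le_c; rewrite !inE eq_k => lt_v.
apply: leq_ltn_trans le_c _; apply: leq_trans lt_v _.
exact: partition_nth_geq.
Qed.

Section OneTableau.
Variable T : tableau d n.
Hypothesis stdT : is_standard lam T.

Lemma std_inj : injective T.
Proof. by case/and4P: stdT => /injectiveP. Qed.

Lemma std_diagram i : T i \in diagram n lam.
Proof. by case/and4P: stdT => _ /eqP <- _ _; apply: imset_f. Qed.

Lemma std_entry u : u \in diagram n lam -> exists i, T i = u.
Proof.
case/and4P: stdT => _ /eqP <- _ _ /imsetP[i _ ->].
by exists i.
Qed.

Lemma std_row i j : node_comp (T i) = node_comp (T j) ->
  node_row (T i) = node_row (T j) -> (node_col (T i) < node_col (T j)) -> i < j.
Proof.
case/and4P: stdT => _ _ /forallP/(_ i)/forallP/(_ j)/implyP h _ e1 e2 e3.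
by apply: h; rewrite e1 e2 e3 !eqxx.
Qed.

Lemma std_col i j : node_comp (T i) = node_comp (T j) ->
  node_col (T i) = node_col (T j) -> (node_row (T i) < node_row (T j)) -> i < j.
Proof.
case/and4P: stdT => _ _ _ /forallP/(_ i)/forallP/(_ j)/implyP h e1 e2 e3.
by apply: h; rewrite e1 e2 e3 !eqxx.
Qed.

(** The corner node in the row of [T i] and the column of [T j] belongs to the diagram, and its
    entry lies between [i] and [j]. *)
Lemma std_le i j : node_le (T i) (T j) -> i <= j.
Proof.
case/and3P=> /eqP eq_k le_r le_c.
have [m Tm] : exists m, T m = (node_comp (T i), node_row (T i), node_col (T j)).
  apply: std_entry; apply: (diagram_down _ (std_diagram j)).
  by rewrite /node_le [node_comp (_, _)]/= eq_k eqxx le_r /= leqnn.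
have le_im : i <= m.
  move: le_c; rewrite leq_eqVlt => /orP[/eqP/val_inj eq_c|lt_c].
    suff -> : i = m by [].
    by apply: std_inj; rewrite Tm -eq_c; case: (T i) => [[]].
  by apply/ltnW/std_row; rewrite Tm.
apply: (leq_trans le_im).
move: le_r; rewrite leq_eqVlt => /orP[/eqP/val_inj eq_r|lt_r].
  suff -> : m = j by [].
  by apply: std_inj; rewrite Tm eq_r eq_k; case: (T j) => [[]].
by apply/ltnW/std_col; rewrite Tm.
Qed.

Lemma std_lt i j : i != j -> node_le (T i) (T j) -> i < j.
Proof. by move=> ne /std_le le; rewrite ltn_neqAle le andbT. Qed.

(** The two other corners of the rectangle spanned by the nodes hold distinct entries strictly
    between [i] and [j]. *)
Lemma std_diag i j : node_comp (T i) = node_comp (T j) ->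
  node_row (T i) < node_row (T j) -> node_col (T i) < node_col (T j) ->
  i + 3 <= j.
Proof.
move=> eq_k lt_r lt_c.
have [m Tm] : exists m, T m = (node_comp (T i), node_row (T i), node_col (T j)).
  apply: std_entry; apply: (diagram_down _ (std_diagram j)).
  by rewrite /node_le [node_comp (_, _)]/= eq_k eqxx /= leqnn (ltnW lt_r).
have [p Tp] : exists p, T p = (node_comp (T i), node_row (T j), node_col (T i)).
  apply: std_entry; apply: (diagram_down _ (std_diagram j)).
  by rewrite /node_le [node_comp (_, _)]/= eq_k eqxx /= leqnn (ltnW lt_c).
have h1 : i < m by apply: std_row; rewrite Tm.
have h2 : i < p by apply: std_col; rewrite Tp.
have h3 : m < j by apply: std_col; rewrite Tm.
have h4 : p < j by apply: std_row; rewrite Tp.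
suff : m != p :> nat by lia.
apply/negP => /eqP/val_inj e; move: Tp; rewrite -e Tm => -[e1 _].
by rewrite e1 ltnn in lt_r.
Qed.

(** Equal contents put two nodes of one component on a common diagonal, where [std_diag] applies.
    Hence entries at distance at most 2 never share both component and content, which keeps the
    denominators of the seminormal form nonzero, also in the braid relation. *)
Lemma std_content i j : i != j -> node_comp (T i) = node_comp (T j) ->
  content (T i) = content (T j) -> (i + 3 <= j) || (j + 3 <= i).
Proof.
rewrite /content => ne eq_k eq_c.
have [lt|gt|eq] := ltngtP (node_row (T i)) (node_row (T j)).
- by rewrite std_diag //; lia.
- by rewrite [X in _ || X]std_diag ?orbT //; lia.
- case/eqP: ne; apply: std_inj; apply: node_eq => //; lia.
Qed.

Lemma std_first i : i = 0 :> nat ->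
  node_row (T i) = 0 :> nat /\ node_col (T i) = 0 :> nat.
Proof.
(* [i] has value 0 and doubles as the row and column index 0. *)
move=> i0; have [m Tm] : exists m, T m = (node_comp (T i), i, i).
  apply: std_entry; apply: (diagram_down _ (std_diagram i)).
  by rewrite /node_le /node_comp /node_row /node_col /= eqxx i0.
have : m <= i.
  by apply: std_le; rewrite /node_le Tm /node_comp /node_row /node_col /= eqxx i0.
rewrite i0 leqn0 => /eqP m0; have <- : m = i by apply: val_inj; rewrite /= m0 i0.
by rewrite Tm.
Qed.
End OneTableau.

(** Aligned nodes are comparable for [node_le], so all standard tableaux fill them in the same
    order. *)
Lemma std_unaligned T U i j i' j' : is_standard lam T -> is_standard lam U ->
  i < j -> j' < i' -> U i' = T i -> U j' = T j -> ~~ aligned (T i) (T j).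
Proof.
move=> sT sU ij ji Ui Uj; apply/negP => /andP[/eqP eq_k al].
have : node_le (T i) (T j) || node_le (T j) (T i).
  by rewrite /node_le eq_k eqxx /=; case/orP: al => /eqP ->;
    rewrite leqnn ?andbT leq_total.
case/orP=> [|/(std_le sT)]; last by rewrite leqNgt ij.
by rewrite -Ui -Uj => /(std_le sU); rewrite leqNgt ji.
Qed.

Lemma tab_swapE T (a : 'I_n.-1) i : permute_tab T (s_ a) i = T (s_ a i).
Proof. by rewrite ffunE tpermV. Qed.

Lemma tab_swapK T (a : 'I_n.-1) :
  permute_tab (permute_tab T (s_ a)) (s_ a) = T.
Proof. by apply/ffunP=> i; rewrite !tab_swapE tpermK. Qed.

Lemma fst_snd (a : 'I_n.-1) : fst_ent a != snd_ent a.
Proof. by rewrite -val_eqE /= neq_ltn ltnSn. Qed.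

Lemma swap_fst (a : 'I_n.-1) : s_ a (fst_ent a) = snd_ent a.
Proof. exact: tpermL. Qed.
Lemma swap_snd (a : 'I_n.-1) : s_ a (snd_ent a) = fst_ent a.
Proof. exact: tpermR. Qed.
Lemma swap_out (a : 'I_n.-1) i : i != a :> nat -> i != a.+1 :> nat -> s_ a i = i.
Proof. by move=> h1 h2; rewrite /s_ tpermD // -val_eqE /= eq_sym. Qed.

Lemma swap_lt (a : 'I_n.-1) i j :
  s_ a i < s_ a j -> i < j \/ i = snd_ent a /\ j = fst_ent a.
Proof.
rewrite /s_; case: tpermP => [->|->|/eqP n1 /eqP n2];
  case: tpermP => [->|->|/eqP n3 /eqP n4] //=; try (by rewrite ltnn);
  try (by right); try by left.
- by rewrite -val_eqE /= in n3; rewrite -val_eqE /= in n4 *; left; lia.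
- by rewrite -val_eqE /= in n3; rewrite -val_eqE /= in n4 *; left; lia.
- by rewrite -val_eqE /= in n1; rewrite -val_eqE /= in n2 *; left; lia.
- by rewrite -val_eqE /= in n1; rewrite -val_eqE /= in n2 *; left; lia.
Qed.

(** By [swap_lt] only the relative order of the two exchanged entries changes, and standardness
    compares them only when they share a row or a column of one component. *)
Lemma std_swap T (a : 'I_n.-1) : is_standard lam T ->
  is_standard lam (permute_tab T (s_ a)) =
  ~~ aligned (T (fst_ent a)) (T (snd_ent a)).
Proof.
move=> sT; apply/idP/idP => [sU|nal].
  apply: (std_unaligned sT sU (i' := snd_ent a) (j' := fst_ent a)) => //;
    by rewrite tab_swapE ?swap_fst ?swap_snd.
apply/and4P; split.
- by apply/injectiveP => i j; rewrite !tab_swapE => /(std_inj sT)/perm_inj.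
- case/and4P: sT => _ /eqP <- _ _; apply/eqP/setP=> u.
  apply/imsetP/imsetP => -[i _ ->]; last first.
    by exists (s_ a i) => //; rewrite tab_swapE tpermK.
  by exists (s_ a i) => //; rewrite tab_swapE.
- apply/forallP=> i; apply/forallP=> j; apply/implyP; rewrite !tab_swapE.
  case/and3P=> /eqP e1 /eqP e2 h.
  have [//|[ei ej]] := swap_lt (std_row sT e1 e2 h).
  move: e1 e2; rewrite ei ej swap_snd swap_fst => e1 e2.
  by rewrite /aligned e1 e2 !eqxx ?orbT in nal.
- apply/forallP=> i; apply/forallP=> j; apply/implyP; rewrite !tab_swapE.
  case/and3P=> /eqP e1 /eqP e2 h.
  have [//|[ei ej]] := swap_lt (std_col sT e1 e2 h).
  move: e1 e2; rewrite ei ej swap_snd swap_fst => e1 e2.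
  by rewrite /aligned e1 e2 !eqxx ?orbT in nal.
Qed.

(** No third node lies between those of two consecutive entries for [node_le], so aligned ones are
    adjacent. Unaligned ones are in northeast-southwest position, where contents differ by at least
    2. *)
Lemma aligned_content T (a : 'I_n.-1) : is_standard lam T ->
  let u := T (fst_ent a) in let v := T (snd_ent a) in
  node_comp u = node_comp v ->
  aligned u v = (content v == content u + 1)%R || (content v == content u - 1)%R.
Proof.
move=> sT u v eq_k; rewrite /aligned eq_k eqxx /=.
have no_between w : node_le u w -> node_le w v -> w = u \/ w = v.
  move=> uw wv; have [m Tm] := std_entry sT (diagram_down wv (std_diagram sT _)).
  have := std_le (i := fst_ent a) (j := m) sT; rewrite Tm => /(_ uw) /= le1.
  have := std_le (i := m) (j := snd_ent a) sT; rewrite Tm => /(_ wv) /= le2.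
  have [e|ne] := eqVneq (m : nat) a.
    by left; rewrite -Tm; congr (T _); apply: val_inj.
  by right; rewrite -Tm; congr (T _); apply: val_inj => /=; lia.
have not_le : ~~ node_le v u.
  by apply/negP => /(std_le sT) /=; rewrite ltnn.
have not_diag : ~~ ((node_row u < node_row v) && (node_col u < node_col v)).
  by apply/andP => -[h1 h2]; have := std_diag sT eq_k h1 h2 => /=; lia.
have row_adj : node_row u = node_row v :> nat ->
    node_col u < node_col v -> node_col v = (node_col u).+1 :> nat.
  move=> er lt; have lt_n := leq_ltn_trans lt (ltn_ord _).
  have [||e|<- //] := no_between (node_comp u, node_row u, Ordinal lt_n).
  - by rewrite /node_le !eqxx leqnn leqnSn.
  - by rewrite /node_le [node_comp (_, _)]/= eq_k eqxx er leqnn.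
  - by have /= := congr1 (fun w => val (node_col w)) e; lia.
have col_adj : node_col u = node_col v :> nat ->
    node_row u < node_row v -> node_row v = (node_row u).+1 :> nat.
  move=> er lt; have lt_n := leq_ltn_trans lt (ltn_ord _).
  have [||e|<- //] := no_between (node_comp u, Ordinal lt_n, node_col u).
  - by rewrite /node_le !eqxx leqnn leqnSn.
  - by rewrite /node_le [node_comp (_, _)]/= eq_k eqxx er leqnn lt.
  - by have /= := congr1 (fun w => val (node_row w)) e; lia.
move: not_le; rewrite /node_le eq_k eqxx /content -!val_eqE /= => not_le.
lia.
Qed.

(** * Row reading order and connectedness of standard tableaux under swaps *)

Definition reading_key u : nat := (node_comp u * n + node_row u) * n + node_col u.

(** Rows and columns are smaller than [n], so a node is recovered from its key by divisions with
    remainder. *)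
Lemma reading_key_inj : injective reading_key.
Proof.
move=> u v; rewrite /reading_key => e.
have n0 : 0 < n := leq_ltn_trans (leq0n _) (ltn_ord (node_row u)).
have e1 := congr1 (fun x => x %% n) e; have e2 := congr1 (fun x => x %/ n) e.
rewrite !modnMDl !modn_small ?ltn_ord // in e1.
rewrite !divnMDl // !divn_small ?ltn_ord // !addn0 in e2.
have e3 := congr1 (fun x => x %% n) e2; have e4 := congr1 (fun x => x %/ n) e2.
rewrite !modnMDl !modn_small ?ltn_ord // in e3.
rewrite !divnMDl // !divn_small ?ltn_ord // !addn0 in e4.
by apply: node_eq => //; apply: val_inj.
Qed.

Lemma node_le_key u v : node_le u v -> reading_key u <= reading_key v.
Proof.
case/and3P=> /eqP e le_r le_c; rewrite /reading_key e.
by rewrite leq_add // leq_mul2r leq_add2l le_r orbT.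
Qed.

Definition reading_sorted T :=
  forall i j, i < j -> reading_key (T i) < reading_key (T j).

Lemma reading_sorted_uniq T U : is_standard lam T -> is_standard lam U ->
  reading_sorted T -> reading_sorted U -> T = U.
Proof.
move=> sT sU rT rU.
have srt V : reading_sorted V ->
    sorted ltn [seq reading_key (V i) | i <- enum 'I_n].
  move=> rV; apply: (homo_sorted (e := fun i j : 'I_n => i < j)); first exact: rV.
  have := iota_ltn_sorted 0 n; rewrite -val_enum_ord sorted_map; exact.
have sub V W : is_standard lam V -> is_standard lam W ->
    {subset [seq reading_key (V i) | i <- enum 'I_n]
      <= [seq reading_key (W i) | i <- enum 'I_n]}.
  move=> sV sW x /mapP[i _ ->]; have [j <-] := std_entry sW (std_diagram sV i).
  by apply: map_f; rewrite mem_enum.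
have /eq_in_map e : [seq reading_key (T i) | i <- enum 'I_n] =
    [seq reading_key (U i) | i <- enum 'I_n].
  apply: (irr_sorted_eq ltn_trans ltnn (srt T rT) (srt U rU)) => x.
  by apply/idP/idP; apply: sub.
 apply/ffunP=> i; apply: reading_key_inj.
by apply: e; rewrite mem_enum.
Qed.

Lemma step_increasing (f : 'I_n -> nat) :
  (forall a : 'I_n.-1, f (fst_ent a) < f (snd_ent a)) ->
  forall i j, i < j -> f i < f j.
Proof.
move=> h i [j ltj]; elim: j ltj => // j IHj ltj /=.
rewrite ltnS leq_eqVlt => ij.
have lt_j : j < n.-1 by lia.
have := h (Ordinal lt_j).
rewrite (_ : snd_ent _ = Ordinal ltj); last exact: val_inj.
have [e|ne] := eqVneq (i : nat) j.
  by rewrite (_ : fst_ent _ = i) //; apply: val_inj.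
have lj : j < n by lia.
rewrite (_ : fst_ent _ = Ordinal lj); last exact: val_inj.
by apply: ltn_trans; apply: IHj => /=; lia.
Qed.

(* Decreases when an inversion of the row reading order is swapped away. *)
Definition reading_weight T := \sum_(i < n) (n - i) * reading_key (T i).

(** The swap gives the smaller key to the smaller entry, whose factor [n - i] is larger by one; the
    sum drops by the difference of the two keys. *)
Lemma reading_weight_swap T (a : 'I_n.-1) :
  reading_key (T (snd_ent a)) < reading_key (T (fst_ent a)) ->
  reading_weight (permute_tab T (s_ a)) < reading_weight T.
Proof.
move=> lt; rewrite /reading_weight.
have ne := fst_snd a.
rewrite (bigD1 (fst_ent a)) // (bigD1 (snd_ent a)) 1?eq_sym //=.
rewrite [X in _ < X](bigD1 (fst_ent a)) // [X in _ < _ + X](bigD1 (snd_ent a)) 1?eq_sym //=.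
rewrite !tab_swapE swap_fst swap_snd !addnA.
rewrite (eq_bigr (fun i : 'I_n => (n - i) * reading_key (T i))); last first.
  by move=> i /andP[h1 h2]; rewrite tab_swapE swap_out.
rewrite ltn_add2r.
have := ltn_ord (snd_ent a) => /= lt_n.
have -> : n - a = (n - a.+1).+1 by lia.
move: (n - a.+1) => c; move: lt.
move: (reading_key _) (reading_key _) => x y lt; rewrite !mulSn; nia.
Qed.

(** Undoing inversions of the reading order leads from any standard tableau, through standard
    tableaux, to the unique reading-sorted one. A swap is its own inverse, so [P] travels both ways
    along this path. *)
Lemma std_connected T U : is_standard lam T -> is_standard lam U ->
  forall P : tableau d n -> Prop,
  (forall V (a : 'I_n.-1), is_standard lam V ->
     is_standard lam (permute_tab V (s_ a)) -> P V -> P (permute_tab V (s_ a))) ->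
  P T -> P U.
Proof.
move=> sT sU P Pswap.
suff to_sorted m V : reading_weight V < m -> is_standard lam V ->
    exists W, [/\ is_standard lam W, reading_sorted W & P V <-> P W].
  have [T' [sT' rT' PT]] := to_sorted _ T (ltnSn _) sT.
  have [U' [sU' rU' PU]] := to_sorted _ U (ltnSn _) sU.
  by move=> /PT; rewrite (reading_sorted_uniq sT' sU') // => /PU.
elim: m V => // m IHm V lt_m sV.
have [/forallP rV|] := boolP [forall a : 'I_n.-1,
    reading_key (V (fst_ent a)) < reading_key (V (snd_ent a))].
  by exists V; split=> //; apply: (step_increasing (f := fun i => reading_key (V i))).
rewrite negb_forall => /existsP[a]; rewrite -leqNgt leq_eqVlt => /orP[/eqP|lt].
  by move/reading_key_inj/(std_inj sV)/eqP; rewrite eq_sym (negPf (fst_snd a)).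
(* Aligned nodes are comparable, and either order contradicts the inversion of the keys or the
   standardness of [V]. *)
have sV' : is_standard lam (permute_tab V (s_ a)).
  rewrite std_swap //; apply/negP => /andP[/eqP eq_k al].
  have : node_le (V (fst_ent a)) (V (snd_ent a)) ||
         node_le (V (snd_ent a)) (V (fst_ent a)).
    by rewrite /node_le eq_k eqxx /=; case/orP: al => /eqP ->;
      rewrite leqnn ?andbT leq_total.
  case/orP=> [/node_le_key|/(std_le sV)]; first by rewrite leqNgt lt.
  by rewrite /= ltnn.
have [|W [sW rW PW]] := IHm _ _ sV'.
  by rewrite -ltnS; apply: leq_trans lt_m; apply: reading_weight_swap.
exists W; split=> //; rewrite -PW; split; first exact: Pswap.
by move/(Pswap _ a sV'); rewrite tab_swapK; apply.
Qed.

(** At the least entry where [T] and [U] differ, the two nodes lie on one diagonal. The one nearer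
    to the corner carries in the other tableau a smaller entry, on which both tableaux agree; this
    contradicts injectivity. *)
Lemma std_determined T U : is_standard lam T -> is_standard lam U ->
  (forall i, node_comp (T i) = node_comp (U i)) ->
  (forall i, content (T i) = content (U i)) -> T = U.
Proof.
move=> sT sU eq_k eq_c.
suff eqTU m i : i < m -> T i = U i by apply/ffunP=> i; apply: (eqTU n).
elim: m i => // m IHm i; rewrite ltnS leq_eqVlt => /orP[/eqP im|]; last exact: IHm.
wlog lt : T U sT sU eq_k eq_c IHm / node_row (T i) < node_row (U i).
  move=> h; have [lt|gt|eq] := ltngtP (node_row (T i)) (node_row (U i)).
  - by apply: (h T U).
  - by symmetry; apply: (h U T) => // j /IHm ->.
  - apply: node_eq => //; have := eq_c i; rewrite /content; lia.
have le : node_le (T i) (U i).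
  by rewrite /node_le eq_k eqxx (ltnW lt); have := eq_c i; rewrite /content; lia.
have [j Uj] := std_entry sU (std_diagram sT i).
have lt_ji : j < i.
  apply: (std_lt sU); last by rewrite Uj.
  by apply/eqP => e; move: lt; rewrite -Uj e ltnn.
have := IHm j; rewrite -im => /(_ lt_ji); rewrite Uj => /(std_inj sT) e.
by rewrite e ltnn in lt_ji.
Qed.

(** * Existence of a standard tableau *)

Section Existence.
Hypothesis lam_sum : \sum_(k < d) sumn (lam k) = n.

Lemma card_diagram : #|diagram n lam| = n.
Proof.
rewrite -sum1_card big_mkcond /=.
transitivity (\sum_(k < d) \sum_(x < n) \sum_(y < n)
    if ((k, x, y) : node d n) \in diagram n lam then 1 else 0).
  by rewrite pair_bigA pair_bigA /=; apply: eq_bigr => -[[k x] y].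
rewrite -[RHS]lam_sum.
apply: eq_bigr => k _.
have /andP[_ /partition_size_sumn sz] := lam_part k.
have le_n : sumn (lam k) <= n by rewrite -lam_sum (bigD1 k) //= leq_addr.
transitivity (\sum_(x < n) nth 0 (lam k) x).
  apply: eq_bigr => x _.
  have le_nth : nth 0 (lam k) x <= n by apply: leq_trans le_n; apply: nth_sumn.
  rewrite -[RHS]card_ord -sum1_card (big_ord_widen n (fun=> 1)) // [RHS]big_mkcond /=.
  by apply: eq_bigr => y _; rewrite inE.
rewrite sumnE [RHS](big_nth 0) -(big_mkord xpredT (nth 0 (lam k))).
rewrite (big_cat_nat (n := size (lam k))) ?(leq_trans sz) //=.
rewrite [X in _ + X]big1_seq ?addn0 // => x /=.
by rewrite mem_index_iota => /andP[h _]; rewrite nth_default.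
Qed.

(** Placing [i] at the [i]-th node in key order gives a standard filling, because the key is
    monotone for [node_le]. The node [u0] is the default value of [nth]. *)
Lemma reading_tableau (u0 : node d n) : exists2 T, is_standard lam T & reading_sorted T.
Proof.
pose le u v := reading_key u <= reading_key v.
pose s := sort le (enum (diagram n lam)).
have le_tr : transitive le by move=> b a c; apply: leq_trans.
have le_tot : total le by move=> a b; apply: leq_total.
have srt : sorted le s by apply: sort_sorted.
have sz : size s = n by rewrite size_sort -cardE card_diagram.
have us : uniq s by rewrite sort_uniq enum_uniq.
have ms u : (u \in s) = (u \in diagram n lam) by rewrite mem_sort mem_enum.
pose T : tableau d n := [ffun i : 'I_n => nth u0 s i].
have Tle i j : j <= i -> reading_key (T j) <= reading_key (T i).
  move=> ji; rewrite !ffunE.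
  by apply: (sorted_leq_nth le_tr _ u0 srt); rewrite ?inE ?sz // => x; apply: leqnn.
have Tinj : injective T.
  by move=> i j; rewrite !ffunE => /eqP; rewrite nth_uniq ?sz // => /eqP/val_inj.
have Tlt i j : node_le (T i) (T j) -> T i != T j -> i < j.
  move=> /node_le_key le_ij; apply: contraNltn => /Tle ge_ij.
  by apply/eqP/reading_key_inj/eqP; rewrite eqn_leq le_ij.
exists T.
  apply/and4P; split.
  - exact/injectiveP.
  - apply/eqP/setP=> u; rewrite -ms; apply/imsetP/idP => [[i _ ->]|us'].
      by rewrite ffunE mem_nth ?sz.
    have lt : index u s < n by have := index_mem u s; rewrite us' sz.
    by exists (Ordinal lt); rewrite ?ffunE ?nth_index.
  - apply/forallP=> i; apply/forallP=> j; apply/implyP.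
    case/and3P=> /eqP e1 /eqP e2 h; apply: Tlt.
      by rewrite /node_le e1 e2 eqxx leqnn ltnW.
    by apply/eqP => e; rewrite e ltnn in h.
  - apply/forallP=> i; apply/forallP=> j; apply/implyP.
    case/and3P=> /eqP e1 /eqP e2 h; apply: Tlt.
      by rewrite /node_le e1 e2 eqxx leqnn ltnW.
    by apply/eqP => e; rewrite e ltnn in h.
move=> i j ij; rewrite ltn_neqAle Tle ?(ltnW ij) // andbT.
by apply/eqP => /reading_key_inj/Tinj e; rewrite e ltnn in ij.
Qed.
End Existence.
End StandardTableaux.

(** * Positions of the first three entries *)

Section FirstEntries.
Variables (d n : nat) (lam : 'I_d -> seq nat).
Hypothesis lam_part : forall k, is_partition (lam k).
Implicit Types (T : tableau d n).

Lemma nth_ncols (s : seq nat) x : nth 0 s x <= ncols s.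
Proof.
have [lt|ge] := ltnP x (size s); last by rewrite nth_default.
by rewrite /ncols; apply: (@leq_bigmax_seq _ s xpredT id) => //; apply: mem_nth.
Qed.

Lemma ncols_nth0 k : ncols (lam k) = nth 0 (lam k) 0.
Proof.
apply/eqP; rewrite eqn_leq nth_ncols andbT; apply/bigmax_leqP_seq => r r_in _.
by rewrite -(nth_index 0 r_in); apply: partition_nth_geq.
Qed.

(** The entry 2 sits below 1 or to its right; in the second case the first row is full and 3 must go
    below 1. The entries 1, 2, 3 are the ordinals of value 0, 1, 2. *)
Lemma two_columns_first_entries T (a b c : 'I_n) : is_standard lam T ->
  a = 0 :> nat -> b = 1 :> nat -> c = 2 :> nat ->
  node_comp (T a) = node_comp (T b) -> node_comp (T b) = node_comp (T c) ->
  ncols (lam (node_comp (T a))) <= 2 ->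
  content (T a) = 0%R /\ (content (T b) = (- 1)%R \/
    content (T b) = 1%R /\ content (T c) = (- 1)%R).
Proof.
move=> sT a0 b1 c2 eab ebc two.
have [ra ca] := std_first lam_part sT a0.
have col_le (e : 'I_n) : node_comp (T a) = node_comp (T e) -> node_col (T e) <= 1.
  move=> ek; have := std_diagram sT e; rewrite inE -ek => h.
  by have := nth_ncols (lam (node_comp (T a))) (node_row (T e)); lia.
have no_diag (e : 'I_n) : node_comp (T a) = node_comp (T e) -> e <= 2 ->
    node_row (T e) = 0 :> nat \/ node_col (T e) = 0 :> nat.
  move=> ek e2; have := @std_diag _ _ _ lam_part _ sT a e ek; lia.
have ne (e f : 'I_n) : node_comp (T e) = node_comp (T f) -> e != f :> nat ->
    node_row (T e) = node_row (T f) :> nat ->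
    node_col (T e) = node_col (T f) :> nat -> False.
  move=> ek /eqP nef er ec; apply: nef; congr (nat_of_ord _).
  by apply: (std_inj sT); apply: node_eq.
split; first by rewrite /content ra ca.
have eac := etrans eab ebc.
have nab := ne a b eab ltac:(lia); have nac := ne a c eac ltac:(lia).
have nbc := ne b c ebc ltac:(lia).
have cb := col_le b eab; have cc := col_le c eac.
have db := no_diag b eab ltac:(lia); have dc := no_diag c eac ltac:(lia).
have below (e : 'I_n) : 1 < node_row (T e) ->
    exists m : 'I_n, [/\ m < e, node_row (T m) = 1 :> nat &
                        node_col (T m) = node_col (T e) :> nat].
  move=> lt1; have lt_n := ltn_trans lt1 (ltn_ord (node_row (T e))).
  have [|m Tm] := std_entry sT (u := (node_comp (T e), Ordinal lt_n, node_col (T e))).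
    apply: (diagram_down lam_part _ (std_diagram sT e)).
    by rewrite /node_le !eqxx leqnn /= ltnW.
  exists m; rewrite Tm; split=> //; apply: (std_lt lam_part sT).
    by apply/eqP => em; rewrite -em Tm in lt1.
  by rewrite /node_le Tm !eqxx leqnn /= ltnW.
have rb : node_row (T b) <= 1.
  rewrite leqNgt; apply/negP => /below[m [lt_m rm _]].
  have e : m = a by apply: val_inj => /=; lia.
  by rewrite e ra in rm.
have rc : node_row (T c) <= 1 \/
    node_row (T b) = 1 :> nat /\ node_col (T b) = node_col (T c) :> nat.
  have [/below[m [lt_m rm cm]]|] := ltnP 1 (node_row (T c)); last by left.
  have [e|ne_a] := eqVneq m a; first by rewrite e ra in rm.
  have e : m = b by apply: val_inj; move: ne_a; rewrite -val_eqE /=; lia.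
  by right; rewrite -cm -rm e.
rewrite /content; lia.
Qed.

(** In reading order the entry [m] has key at least [m], while the node [(k, a, y)] has key [y]
    because [k] and [a] have index 0. So the entries of the first three nodes of the first row are
    at most 0, 1, 2, and being distinct they are 0, 1, 2. *)
Lemma three_columns_first_entries T (k : 'I_d) (a b c : 'I_n) :
  is_standard lam T -> reading_sorted T -> k = 0 :> nat ->
  2 < nth 0 (lam k) 0 ->
  a = 0 :> nat -> b = 1 :> nat -> c = 2 :> nat ->
  [/\ node_comp (T a) = k, node_comp (T b) = k & node_comp (T c) = k] /\
  [/\ content (T a) = 0%R, content (T b) = 1%R & content (T c) = 2%R].
Proof.
move=> sT rT k0 lt2 a0 b1 c2.
have key_ge m (i : 'I_n) : i = m :> nat -> m <= reading_key (T i).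
  elim: m i => // m IHm i im.
  have lt_m : m < n by apply: leq_ltn_trans (ltn_ord i); rewrite im.
  apply: leq_ltn_trans (IHm (Ordinal lt_m) erefl) _.
  by apply: rT; rewrite im /=.
have entry (y : 'I_n) : y <= 2 -> exists2 m : 'I_n, T m = (k, a, y) & m <= y.
  move=> y2; have [|m Tm] := std_entry sT (u := (k, a, y)).
    by rewrite inE /node_col /node_comp /node_row /= a0; apply: leq_ltn_trans lt2.
  exists m => //; have := key_ge m m erefl.
  by rewrite Tm /reading_key /node_col /node_comp /node_row /= k0 a0 mul0n.
have [ma Ta la] := entry a ltac:(lia).
have [mb Tb lb] := entry b ltac:(lia).
have [mc Tc lc] := entry c ltac:(lia).
have ea : ma = a by apply: val_inj => /=; lia.
rewrite {}ea in Ta.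
have nab : mb != a.
  by apply/eqP => e; move: Tb; rewrite e Ta => -[e1]; move: b1; rewrite -e1 a0.
have eb : mb = b by apply: val_inj => /=; move: nab; rewrite -val_eqE /=; lia.
rewrite {}eb in Tb.
have nac : mc != a.
  by apply/eqP => e; move: Tc; rewrite e Ta => -[e1]; move: c2; rewrite -e1 a0.
have nbc : mc != b.
  by apply/eqP => e; move: Tc; rewrite e Tb => -[e1]; move: c2; rewrite -e1 b1.
have ec : mc = c.
  by apply: val_inj => /=; move: nac nbc; rewrite -!val_eqE /=; lia.
rewrite {}ec in Tc.
rewrite Ta Tb Tc /content /node_col /node_comp /node_row /=.
by rewrite a0 b1 c2.
Qed.
End FirstEntries.

Local Open Scope ring_scope.

(** * Universal properties *)

Section Elements.
Variables (E : nzRingType) (d n : nat) (c : E) (t : 'I_n -> E) (g : 'I_n.-1 -> E).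

(** Counterparts of [e_], [T_] and [g12_] in a ring without [algOverType] structure; [c] stands for
    the image of 1/d. *)
Definition e_elt i : E :=
  c * \sum_(k < d) t (fst_ent i) ^+ k * t (snd_ent i) ^+ (d - k).

Definition T_elt j : E := c * \sum_(k < d) t j ^+ k.

Definition g12_elt i j : E :=
  1 + g i + g j + g i * g j + g j * g i + g i * g j * g i.
End Elements.

Section AlgebraMorphisms.
Variables (A : comNzRingType) (E : pzRingType) (s : A -> E).

Record alg_morph (B : algOverType A) (f : B -> E) : Prop := AlgMorph {
  alg_morph1 : f 1 = 1;
  alg_morphD : forall x y, f (x + y) = f x + f y;
  alg_morphM : forall x y, f (x * y) = f x * f y;
  alg_morph_scal : forall a, f (scal a) = s a
}.

Section Theory.
Variables (B : algOverType A) (f : B -> E).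
Hypothesis fM : alg_morph f.

Lemma alg_morph0 : f 0 = 0.
Proof. by apply: (addrI (f 0)); rewrite -(alg_morphD fM) !addr0. Qed.

Lemma alg_morphN x : f (- x) = - f x.
Proof.
by apply: (addrI (f x)); rewrite -(alg_morphD fM) !subrr alg_morph0.
Qed.

Lemma alg_morphB x y : f (x - y) = f x - f y.
Proof. by rewrite (alg_morphD fM) alg_morphN. Qed.

Lemma alg_morphX x k : f (x ^+ k) = f x ^+ k.
Proof.
elim: k => [|k IHk]; first by rewrite !expr0 (alg_morph1 fM).
by rewrite !exprS (alg_morphM fM) IHk.
Qed.

Lemma alg_morph_sum I (r : seq I) (P : pred I) (F : I -> B) :
  f (\sum_(i <- r | P i) F i) = \sum_(i <- r | P i) f (F i).
Proof. exact: (big_morph f (alg_morphD fM) alg_morph0). Qed.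

Lemma alg_morph_comm a b c e : f (a * b - c * e) = f a * f b - f c * f e.
Proof. by rewrite alg_morphB !(alg_morphM fM). Qed.

Lemma alg_morph_braid a b :
  f (a * b * a - b * a * b) = f a * f b * f a - f b * f a * f b.
Proof. by rewrite alg_morphB !(alg_morphM fM). Qed.

Lemma alg_morph_unipotent a k : f (a ^+ k - 1) = f a ^+ k - 1.
Proof. by rewrite alg_morphB alg_morphX (alg_morph1 fM). Qed.

Lemma alg_morph_quad a p p' e : f (a ^+ 2 - (scal p + scal p' * e * a)) =
  f a ^+ 2 - (s p + s p' * f e * f a).
Proof.
rewrite alg_morphB alg_morphX (alg_morphD fM) !(alg_morphM fM).
by rewrite !(alg_morph_scal fM).
Qed.
End Theory.

(** A map killing the generators kills the ideal, so its value does not depend on the representative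
    chosen by [repr]. *)
Lemma quotalg_lift (B : algOverType A) (S : B -> Prop) (f : B -> E) :
  alg_morph f -> (forall x, S x -> f x = 0) ->
  exists2 f' : quotalg S -> E, alg_morph f' & forall x, f' (qproj S x) = f x.
Proof.
move=> fM fS; have f_ideal x : ideal_gen S x -> f x = 0.
  elim=> [{}x /fS|||z {}x _ fx|{}x z _ fx] //; first exact: alg_morph0.
  - by move=> {}x y _ fx _ fy; rewrite (alg_morphD fM) fx fy addr0.
  - by rewrite (alg_morphM fM) fx mulr0.
  - by rewrite (alg_morphM fM) fx mul0r.
have f_repr x : f (repr (qproj S x)) = f x.
  by apply/eqP; rewrite -subr_eq0 -alg_morphB // f_ideal //; apply: repr_qproj.
exists (fun u => f (repr u)) => //; split=> [|u w|u w|a].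
- by rewrite f_repr (alg_morph1 fM).
- by rewrite f_repr (alg_morphD fM).
- by rewrite f_repr (alg_morphM fM).
- by rewrite f_repr (alg_morph_scal fM).
Qed.
End AlgebraMorphisms.

Section Projection.
Variables (A : comNzRingType) (B : algOverType A) (S : B -> Prop).

Lemma qproj_morph : alg_morph (scal : A -> quotalg S) (qproj S).
Proof. by split=> // x y; rewrite -?qaddE -?qmulE. Qed.
End Projection.

Section FreeLift.
Variables (A : comNzRingType) (X : choiceType) (E : nzRingType).
Variables (s : {rmorphism A -> E}) (h : X -> E).
Hypothesis s_central : forall a x, s a * x = x * s a.

Definition word_eval (m : {fmonom X}) : E := \prod_(x <- (m : seq X)) h x.

Fact word_eval_mmorphism : monalg.mmorphism word_eval.
Proof.
split=> [m1 m2|]; first by rewrite /word_eval fmM big_cat.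
by rewrite /word_eval fm1 big_nil.
Qed.
HB.instance Definition _ :=
  monalg.isMultiplicative.Build {fmonom X} E word_eval word_eval_mmorphism.

Lemma freealg_lift : exists2 f : freealg A X -> E,
  alg_morph s f & forall x, f (fvar x) = h x.
Proof.
have [fM f1] := commr_mmap_is_multiplicative (f := s) (h := word_eval)
  (fun _ _ _ => s_central _ _).
exists (mmap s word_eval); last first.
  move=> x; transitivity (s 1 * word_eval (fmu x)); first exact: mmapU.
  by rewrite rmorph1 mul1r /word_eval fmU big_seq1.
by split=> [|x y|x y|a] //; [apply: raddfD|apply: mmapC].
Qed.
End FreeLift.

Section ScalarExtensionLift.
Variables (A K : comNzRingType) (f : {rmorphism A -> K}) (B : algOverType A).

Lemma ext_in_morph :
  alg_morph (fun a => scal (f a) : scalar_ext f B) (ext_in f (B := B)).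
Proof.
have qM := qproj_morph (ext_rel f (B := B)).
split=> [|x y|x y|a]; rewrite /ext_in.
- rewrite -(alg_morph1 qM); apply/qprojP/ideal_mem; exact: ext_rel1.
- rewrite -(alg_morphD qM); apply/qprojP/ideal_mem; exact: ext_relD.
- rewrite -(alg_morphM qM); apply/qprojP/ideal_mem; exact: ext_relM.
- rewrite -(alg_morph_scal qM); apply/qprojP/ideal_mem; exact: ext_relZ.
Qed.

Lemma alg_morph_ext_in (E : pzRingType) (s : K -> E) (psi : scalar_ext f B -> E) :
  alg_morph s psi -> alg_morph (s \o f) (fun b => psi (ext_in f b)).
Proof.
case=> psi1 psiD psiM psis; have [i1 iD iM iS] := ext_in_morph.
split=> [|x y|x y|a].
- by rewrite i1 psi1.
- by rewrite iD psiD.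
- by rewrite iM psiM.
- by rewrite iS psis.
Qed.

(** The free [K]-algebra on the underlying set of [B] maps to [E] through [phi]; the relations
    [ext_rel] hold in [E] because [phi] is a ring morphism with the right scalars. *)
Lemma scalar_ext_lift (E : nzRingType) (s : {rmorphism K -> E}) (phi : B -> E) :
  (forall a x, s a * x = x * s a) -> alg_morph (s \o f) phi ->
  exists2 psi : scalar_ext f B -> E, alg_morph s psi &
    forall b, psi (ext_in f b) = phi b.
Proof.
move=> s_central phiM; have [F FM Fvar] := freealg_lift phi s_central.
have [|psi psiM psiE] := quotalg_lift (S := ext_rel f (B := B)) FM.
  move=> _ [|x y|x y|a]; rewrite (alg_morphB FM).
  - by rewrite Fvar (alg_morph1 phiM) (alg_morph1 FM) subrr.
  - by rewrite (alg_morphD FM) !Fvar (alg_morphD phiM) subrr.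
  - by rewrite (alg_morphM FM) !Fvar (alg_morphM phiM) subrr.
  - by rewrite Fvar (alg_morph_scal phiM) (alg_morph_scal FM) subrr.
by exists psi => // b; rewrite psiE Fvar.
Qed.
End ScalarExtensionLift.

(** * Seminormal coefficients *)

Section SeminormalCoefficients.
Variables (K : fieldType) (q : K) (d : nat).
Hypotheses (q_neq0 : q != 0) (qX_inj : injective (exprz q)).
Implicit Types x y z : 'I_d * int.

(** Pairs are labels (component, content). For the labels of i and i+1, [stay_coef] and [swap_coef]
    are the coefficients of v_T and of v_{T^{s_i}} in g_i(v_T). *)
Definition stay_coef x y : K :=
  if x.1 == y.1 then (q * q ^ y.2 - q ^ y.2) / (q ^ y.2 - q ^ x.2) else 0.

Definition swap_coef x y : K :=
  if (y.1 < x.1)%N then 1 else if (x.1 < y.1)%N then q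
  else (q * q ^ y.2 - q ^ x.2) / (q ^ y.2 - q ^ x.2).

Definition generic x y := x.1 = y.1 -> x.2 <> y.2.

Lemma generic_sym x y : generic x y -> generic y x.
Proof. by move=> h e1 e2; apply: h. Qed.

Lemma generic_sub x y : x.1 = y.1 -> generic x y -> q ^ y.2 - q ^ x.2 != 0.
Proof.
by move=> e h; rewrite subr_eq0; apply/eqP => /qX_inj e2; apply: (h e).
Qed.

(** This is the determinant, and [stay_coef_add] the trace, of the 2 by 2 block of g_i on v_T and
    v_{T^{s_i}}; together they encode the quadratic relation. *)
Lemma swap_coef_mul x y : generic x y ->
  swap_coef x y * swap_coef y x =
  q + (q - 1) * (x.1 == y.1)%:R * stay_coef x y - stay_coef x y ^+ 2.
Proof.
move=> g; rewrite /swap_coef /stay_coef.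
have [lt|gt|/val_inj e] := ltngtP (x.1 : nat) y.1.
- by rewrite -val_eqE /= (ltn_eqF lt) mulr0n /=; ring.
- by rewrite -val_eqE /= (gtn_eqF gt) mulr0n /=; ring.
rewrite e eqxx /=.
have h1 := generic_sub e g; have h2 := generic_sub (esym e) (generic_sym g).
by field; rewrite h1 h2.
Qed.

Lemma stay_coef_add x y : generic x y ->
  stay_coef x y + stay_coef y x = (q - 1) * (x.1 == y.1)%:R.
Proof.
move=> g; rewrite /stay_coef eq_sym.
have [/esym e|_] := eqVneq; last by rewrite mulr0n; ring.
have h1 := generic_sub e g; have h2 := generic_sub (esym e) (generic_sym g).
by rewrite mulr1n; field; rewrite h1 h2.
Qed.

(** Coefficient of v_{T^{s_i}} in the braid relation; [stay_coef_braid3] is that of v_{T^{s_{i+1}}}.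
    Each product involves all three labels, hence vanishes unless the three components agree. *)
Lemma stay_coef_braid2 x y z : generic x y -> generic y z -> generic x z ->
  stay_coef x y * stay_coef y z + stay_coef x z * stay_coef y x =
  stay_coef y z * stay_coef x z.
Proof.
move=> gxy gyz gxz; rewrite /stay_coef.
have [exy|nxy] := eqVneq x.1 y.1; last first.
  by have [<-|_] := eqVneq y.1 z.1; rewrite ?(negPf nxy); ring.
have [eyz|nyz] := eqVneq y.1 z.1; last by rewrite exy (negPf nyz); ring.
rewrite exy eyz eqxx.
have h1 := generic_sub exy gxy.
have h2 := generic_sub eyz gyz.
have h3 := generic_sub (etrans exy eyz) gxz.
have h4 := generic_sub (esym exy) (generic_sym gxy).
by field; rewrite h1 h2 h3 h4.
Qed.

Lemma stay_coef_braid3 x y z : generic x y -> generic y z -> generic x z ->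
  stay_coef x y * stay_coef x z =
  stay_coef x z * stay_coef z y + stay_coef y z * stay_coef x y.
Proof.
move=> gxy gyz gxz; rewrite /stay_coef.
have [exy|nxy] := eqVneq x.1 y.1; last first.
  by have [<-|_] := eqVneq y.1 z.1; rewrite ?(negPf nxy); ring.
have [eyz|nyz] := eqVneq y.1 z.1; last by rewrite exy (negPf nyz); ring.
rewrite exy eyz eqxx.
have h1 := generic_sub exy gxy.
have h2 := generic_sub eyz gyz.
have h3 := generic_sub (etrans exy eyz) gxz.
have h4 := generic_sub (esym eyz) (generic_sym gyz).
by field; rewrite h1 h2 h3 h4.
Qed.

(** Coefficient of v_T in the braid relation. When only the components of [x] and [z] agree, both
    sides reduce to [q * stay_coef x z]. *)
Lemma stay_coef_braid1 x y z : generic x y -> generic y z -> generic x z ->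
  stay_coef x y * stay_coef y z * stay_coef x y
    + swap_coef x y * swap_coef y x * stay_coef x z =
  stay_coef y z * stay_coef x y * stay_coef y z
    + swap_coef y z * swap_coef z y * stay_coef x z.
Proof.
move=> gxy gyz gxz; rewrite !swap_coef_mul // /stay_coef.
have [exy|nxy] := eqVneq x.1 y.1; last first.
  by have [<-|_] := eqVneq y.1 z.1; rewrite ?(negPf nxy) ?mulr0n; ring.
have [eyz|nyz] := eqVneq y.1 z.1; last by rewrite exy (negPf nyz) ?mulr0n; ring.
rewrite exy eyz eqxx mulr1n.
have h1 := generic_sub exy gxy.
have h2 := generic_sub eyz gyz.
have h3 := generic_sub (etrans exy eyz) gxz.
by field; rewrite h1 h2 h3.
Qed.

(** Makes the off-diagonal coefficient of g_i J_i g_i vanish, J_i being a Jucys-Murphy element;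
    [stay_coef_content2] computes the diagonal one. *)
Lemma stay_coef_content x y : generic x y ->
  q ^ x.2 * stay_coef x y + q ^ y.2 * stay_coef y x = 0.
Proof.
move=> g; rewrite /stay_coef eq_sym.
have [/esym e|_] := eqVneq; last by ring.
have h1 := generic_sub e g; have h2 := generic_sub (esym e) (generic_sym g).
by field; rewrite h1 h2.
Qed.

Lemma stay_coef_content2 x y : generic x y ->
  q ^ x.2 * stay_coef x y ^+ 2 + q ^ y.2 * (swap_coef x y * swap_coef y x)
  = q * q ^ y.2.
Proof.
move=> g; rewrite swap_coef_mul // /stay_coef.
have [e|_] := eqVneq; last by rewrite mulr0n; ring.
have h1 := generic_sub e g.
by rewrite mulr1n; field.
Qed.
End SeminormalCoefficients.

(** * Relations between operators on spans of a few vectors *)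

Section SeminormalLinear.
Variables (K : fieldType) (V : vectType K).
Variables (g h : 'End(V)).

Lemma lfun_comb (a b : K) (u w : V) : g (a *: u + b *: w) = a *: g u + b *: g w.
Proof. by rewrite linearD !linearZ. Qed.
Lemma lfun_scale (a : K) (u : V) : g (a *: u) = a *: g u.
Proof. exact: linearZ. Qed.

Lemma memv_stable (W : {vspace V}) (u : V) : (g @: W <= W)%VS ->
  u \in W -> g u \in W.
Proof. by move=> /subvP gW uW; apply/gW/memv_img. Qed.
End SeminormalLinear.

Section SeminormalRelations.
Variables (K : fieldType) (V : vectType K).
Variables (g h : 'End(V)) (v v1 v2 v12 v21 v0 : V).

Lemma commute_lin (s t b1 b2 b12 b21 : K) :
  g v = s *: v + b1 *: v1 -> h v = t *: v + b2 *: v2 ->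
  g v2 = s *: v2 + b21 *: v21 -> h v1 = t *: v1 + b12 *: v12 ->
  (b2 * b21) *: v21 = (b1 * b12) *: v12 ->
  g (h v) = h (g v).
Proof.
move=> gv hv gv2 hv1 e.
rewrite gv hv !lfun_comb gv hv gv2 hv1 !scalerDr !scalerA e.
rewrite [LHS](AC (2*2) ((1*3)*(2*4))) /=.
by rewrite ![t * _]mulrC [b2 * s]mulrC.
Qed.

(* With g = g_i and h = g_j, the vectors are those of the six tableaux       *)
(* obtained by permuting three consecutive entries; v0 is the reversed one.  *)
Lemma braid_lin (s t s1 t1 s2 t2 s12 t21 b1 b2 b11 b12 b21 b22 b121 b212 : K) :
  g v = s *: v + b1 *: v1 -> h v = t *: v + b2 *: v2 ->
  g v1 = s1 *: v1 + b11 *: v -> h v1 = t1 *: v1 + b12 *: v12 ->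
  g v2 = s2 *: v2 + b21 *: v21 -> h v2 = t2 *: v2 + b22 *: v ->
  g v12 = s12 *: v12 + b121 *: v0 -> h v21 = t21 *: v21 + b212 *: v0 ->
  s12 = t -> t21 = s -> s2 = t1 ->
  s * t * s + b1 * b11 * t1 = t * s * t + b2 * b22 * t1 ->
  s * t + t1 * s1 = t * t1 -> s * t1 = t1 * t2 + t * s ->
  (b1 * b12 * b121) *: v0 = (b2 * b21 * b212) *: v0 ->
  g (h (g v)) = h (g (h v)).
Proof.
move=> gv hv gv1 hv1 gv2 hv2 gv12 hv21 ? ? ? e1 e2 e3 e0; subst s12 t21 s2.
have e0' : (b1 * (b12 * b121)) *: v0 = (b2 * (b21 * b212)) *: v0.
  by rewrite !mulrA.
rewrite gv hv !lfun_comb gv hv hv1 gv2 !lfun_comb.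
rewrite gv hv gv1 hv2 gv2 hv1 gv12 hv21 !scalerDr !scalerA -!mulrA e0'.
(* Both sides are regrouped along [v], [v1], [v2], [v21], [v12], [v0]; the first three coefficients
   are matched by [e1], [e2], [e3]. *)
rewrite [LHS](AC ((2*2)*(2*2)) (((1*6)*(2*5))*3*4*7*8)) /=.
rewrite [RHS](AC ((2*2)*(2*2)) (((1*6)*3)*(2*5)*7*4*8)) /=.
rewrite -!scalerDl; congr (_ *: _ + _ *: _ + _ *: _ + _ *: _ + _ *: _ + _).
- by transitivity (s * t * s + b1 * b11 * t1); [|rewrite e1]; ring.
- by transitivity ((s * t + t1 * s1) * b1); [|rewrite e2]; ring.
- by transitivity ((s * t1) * b2); [|rewrite e3]; ring.
- by ring.
- by ring.
Qed.

Lemma quad_lin (s s1 b1 b11 p c : K) :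
  g v = s *: v + b1 *: v1 -> g v1 = s1 *: v1 + b11 *: v ->
  s + s1 = c -> b1 * b11 = p + c * s - s ^+ 2 ->
  g (g v) = p *: v + c *: g v.
Proof.
move=> gv gv1 <- e; rewrite gv lfun_comb gv gv1 !scalerDr !scalerA.
rewrite [LHS](AC (2*2) ((1*4)*(2*3))) /= [RHS]addrA -!scalerDl.
by congr (_ *: _ + _ *: _); rewrite ?e; ring.
Qed.

Lemma jucys_murphy_lin (p s s1 b1 b11 c c' : K) : p != 0 ->
  g v = s *: v + b1 *: v1 -> g v1 = s1 *: v1 + b11 *: v ->
  h v = c *: v -> h v1 = c' *: v1 ->
  c * s ^+ 2 + c' * (b1 * b11) = p * c' -> c * s + c' * s1 = 0 ->
  (p^-1 *: (g \o h \o g))%VF v = c' *: v.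
Proof.
move=> p0 gv gv1 hv hv1 e1 e2; rewrite scale_lfunE !comp_lfunE /= gv.
rewrite lfun_comb hv hv1 !scalerA lfun_comb gv gv1 !scalerDr !scalerA.
rewrite [LHS](AC (2*2) ((1*4)*(2*3))) /= -!scalerDl.
rewrite (_ : _ + _ = p^-1 * (c * s ^+ 2 + c' * (b1 * b11))); last by ring.
rewrite e1 mulKf // (_ : _ + _ = p^-1 * b1 * (c * s + c' * s1)); last by ring.
by rewrite e2 mulr0 scale0r addr0.
Qed.
End SeminormalRelations.

(** * The seminormal operators *)

Section TableauModule.
Variables (K : fieldType) (d n : nat) (lam : 'I_d -> seq nat).

Definition tabmod : vectType K := {ffun stdtab n lam -> K^o}.

Definition tabvec (T : tableau d n) : tabmod :=
  [ffun S : stdtab n lam => (val S == T)%:R : K].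

Lemma tabvec_nonstd T : ~~ is_standard lam T -> tabvec T = 0.
Proof.
move=> nT; apply/ffunP=> S; rewrite !ffunE.
by case: eqP => // e; rewrite -e (valP S) in nT.
Qed.

Lemma tabvec_neq0 T : is_standard lam T -> tabvec T != 0.
Proof.
move=> sT; apply/eqP => /ffunP/(_ (Sub T sT)); rewrite !ffunE SubK eqxx => /eqP.
by rewrite oner_eq0.
Qed.

Lemma tabmod_coord (f : tabmod) :
  f = \sum_(S : stdtab n lam) (f S : K) *: tabvec (val S).
Proof.
apply/ffunP=> S; rewrite sum_ffunE (bigD1 S) //= !ffunE eqxx big1 => [|U ne].
  by rewrite addr0 /GRing.scale /= mulr1.
by rewrite !ffunE val_eqE eq_sym (negPf ne) /GRing.scale /= mulr0.
Qed.

Lemma eq_on_tabvec (W : vectType K) (f g : 'Hom(tabmod, W)) :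
  (forall T, is_standard lam T -> f (tabvec T) = g (tabvec T)) -> f = g.
Proof.
move=> h; apply/lfunP => w; rewrite (tabmod_coord w) !linear_sum.
by apply: eq_bigr => S _; rewrite !linearZ /= h // (valP S).
Qed.

Section Extension.
Variable F : tableau d n -> tabmod.

Definition tabext_fun (f : tabmod) : tabmod :=
  \sum_(S : stdtab n lam) (f S : K) *: F (val S).

Fact tabext_linear : linear tabext_fun.
Proof.
move=> a f g; rewrite /tabext_fun scaler_sumr -big_split /=; apply: eq_bigr => S _.
by rewrite !ffunE scalerA -scalerDl.
Qed.
HB.instance Definition _ :=
  GRing.isLinear.Build K tabmod tabmod *:%R tabext_fun tabext_linear.

Definition tabext : 'End(tabmod) := linfun tabext_fun.

Lemma tabextE T : is_standard lam T -> tabext (tabvec T) = F T.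
Proof.
move=> sT; rewrite lfunE /= /tabext_fun (bigD1 (Sub T sT)) //= big1 => [|U ne].
  by rewrite !ffunE SubK eqxx scale1r addr0.
by rewrite ffunE -(SubK (stdtab n lam) sT) val_eqE (negPf ne) scale0r.
Qed.
End Extension.

Lemma diag_coord (D : 'End(tabmod)) (ev : tableau d n -> K) f S :
  (forall T, D (tabvec T) = ev T *: tabvec T) ->
  (D f S : K) = ev (val S) * (f S : K).
Proof.
move=> DE; rewrite {1}(tabmod_coord f) linear_sum sum_ffunE (bigD1 S) //=.
rewrite big1 ?addr0 => [|U ne]; rewrite linearZ /= DE !ffunE.
  by rewrite eqxx /GRing.scale /= mulr1 mulrC.
by rewrite val_eqE eq_sym (negPf ne) /GRing.scale /= !mulr0.
Qed.

End TableauModule.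

Section Labels.
Variables (d n : nat) (lam : 'I_d -> seq nat).
Hypotheses (lam_part : forall k, is_partition (lam k)).
Implicit Types (T : tableau d n) (i : 'I_n.-1).
Local Notation std := (is_standard lam).

Definition label T (a : 'I_n) : 'I_d * int := (node_comp (T a), content (T a)).

Lemma label_swap T i a : label (permute_tab T (s_ i)) a = label T (s_ i a).
Proof. by rewrite /label tab_swapE. Qed.

Lemma label_generic T (a b : 'I_n) : std T -> a != b ->
  (a < b + 3)%N -> (b < a + 3)%N -> generic (label T a) (label T b).
Proof.
move=> sT ne lt1 lt2 /= eq_k /= eq_c.
by have := std_content lam_part sT ne eq_k eq_c; lia.
Qed.

Lemma label_generic_adj T i : std T ->
  generic (label T (fst_ent i)) (label T (snd_ent i)).
Proof. by move=> sT; apply: label_generic => //=; rewrite ?fst_snd //; lia. Qed.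

End Labels.

Section SeminormalForm.
Variables (K : fieldType) (q : K) (d n : nat) (lam : 'I_d -> seq nat).
Variable zeta : 'I_d -> K.
Hypotheses (lam_part : forall k, is_partition (lam k)).
Hypotheses (q_neq0 : q != 0) (qX_inj : injective (exprz q)).
Implicit Types (T U : tableau d n) (i j : 'I_n.-1).
Local Notation V := (tabmod K n lam).
Local Notation v := (@tabvec K d n lam).
Local Notation std := (is_standard lam).
Local Notation sw T i := (permute_tab T (s_ i)).

Definition stay T i := stay_coef q (label T (fst_ent i)) (label T (snd_ent i)).
Definition swap T i := swap_coef q (label T (fst_ent i)) (label T (snd_ent i)).

Definition g_op i : 'End(V) :=
  tabext (fun T => stay T i *: v T + swap T i *: v (sw T i)).

Definition t_op (a : 'I_n) : 'End(V) :=
  tabext (fun T => zeta (node_comp (T a)) *: v T).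

(* Cutting the swap coefficient off makes the formula for [g_op] valid at all *)
(* tableaux, standard or not.                                                 *)
Definition cutswap T i := if std T && std (sw T i) then swap T i else 0.

Lemma g_opE i T : g_op i (v T) = stay T i *: v T + cutswap T i *: v (sw T i).
Proof.
rewrite /cutswap; have [sT|nT] := boolP (std T); last first.
  by rewrite (tabvec_nonstd _ nT) linear0 scaler0 scale0r addr0.
rewrite tabextE //=; case: (boolP (std _)) => // nT.
by rewrite (tabvec_nonstd _ nT) !scaler0.
Qed.

Lemma t_opE a T : t_op a (v T) = zeta (node_comp (T a)) *: v T.
Proof.
have [sT|nT] := boolP (std T); first by rewrite tabextE.
by rewrite (tabvec_nonstd _ nT) linear0 scaler0.
Qed.

Lemma stay_swap T i :
  stay (sw T i) i = stay_coef q (label T (snd_ent i)) (label T (fst_ent i)).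
Proof. by rewrite /stay !label_swap swap_fst swap_snd. Qed.

Lemma q_mulX (z : int) : q * q ^ z = q ^ (1 + z).
Proof. by rewrite expfzDr // expr1z. Qed.

(** The numerator vanishes exactly when the content drops by one from i to i+1. Such entries are
    aligned, so an admissible swap has a nonzero coefficient. *)
Lemma swap_eq0 T i : std T -> (swap T i == 0) =
  (node_comp (T (fst_ent i)) == node_comp (T (snd_ent i))) &&
  (content (T (fst_ent i)) == content (T (snd_ent i)) + 1).
Proof.
move=> sT; have := label_generic_adj lam_part (i := i) sT; rewrite /swap /swap_coef /label /=.
set u := T _; set w := T _ => gen.
have [lt|gt|/val_inj e] := ltngtP (node_comp u : nat) (node_comp w).
- by rewrite (negPf q_neq0) -val_eqE /= (ltn_eqF lt).
- by rewrite oner_eq0 -val_eqE /= (gtn_eqF gt).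
rewrite e eqxx /= mulf_eq0 invr_eq0.
rewrite [X in _ || X](negPf (generic_sub qX_inj _ gen)) // orbF subr_eq0.
by rewrite q_mulX (inj_eq qX_inj) eq_sym addrC.
Qed.

(* When T^{s_i} is not standard, the contents of i and i+1 differ by 1 and   *)
(* one of the two factors on the right vanishes.                             *)
Lemma cutswap_mul T i : std T -> cutswap T i * cutswap (sw T i) i =
  swap_coef q (label T (fst_ent i)) (label T (snd_ent i)) *
  swap_coef q (label T (snd_ent i)) (label T (fst_ent i)).
Proof.
move=> sT; rewrite /cutswap tab_swapK sT /= andbT.
have swE : swap (sw T i) i =
    swap_coef q (label T (snd_ent i)) (label T (fst_ent i)).
  by rewrite /swap !label_swap swap_fst swap_snd.
case: ifP => [_|nal]; first by rewrite swE.
move: nal; rewrite std_swap // => /negbFE al.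
have /andP[/eqP eq_k _] := al; rewrite (aligned_content lam_part sT eq_k) in al.
rewrite mul0r; apply/esym/eqP; rewrite mulf_eq0 [_ == 0 in X in X || _]swap_eq0 //.
rewrite /swap_coef /= eq_k ltnn mulf_eq0 subr_eq0 q_mulX (inj_eq qX_inj).
rewrite eqxx /= orbC; case/orP: al => /eqP ->; last by rewrite subrK eqxx orbT.
by rewrite addrC eqxx.
Qed.

Lemma stay_swap_far T i j : (i.+1 < j)%N || (j.+1 < i)%N ->
  stay (sw T i) j = stay T j /\ swap (sw T i) j = swap T j.
Proof.
move=> far; rewrite /stay /swap !label_swap !swap_out //=; lia.
Qed.

Lemma swap_comm T i j : (i.+1 < j)%N || (j.+1 < i)%N ->
  sw (sw T i) j = sw (sw T j) i.
Proof.
move=> far; apply/ffunP=> a; rewrite !tab_swapE; congr (T _).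
have [e|n1] := eqVneq (a : nat) i.
  have -> : a = fst_ent i by apply: val_inj.
  by rewrite [s_ j _]swap_out ?swap_fst ?swap_out //=; lia.
have [e|n2] := eqVneq (a : nat) i.+1.
  have -> : a = snd_ent i by apply: val_inj.
  by rewrite [s_ j _]swap_out ?swap_snd ?swap_out //=; lia.
rewrite [s_ i a]swap_out // swap_out //.
- by rewrite /s_; case: tpermP => [_|_|_ _] //=; lia.
- by rewrite /s_; case: tpermP => [_|_|_ _] //=; lia.
Qed.

Lemma g_op_far i j : (i.+1 < j)%N || (j.+1 < i)%N ->
  forall T, std T -> g_op i (g_op j (v T)) = g_op j (g_op i (v T)).
Proof.
move=> far T sT; have far' : (j.+1 < i)%N || (i.+1 < j)%N by rewrite orbC.
have [eqi swpj] := stay_swap_far T far; have [eqj swpi] := stay_swap_far T far'.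
(* If [T] and the doubly swapped tableau are standard, neither pair of entries is aligned, so both
   intermediate tableaux are standard too. *)
have cc : cutswap T j * cutswap (sw T j) i *: v (sw (sw T j) i)
        = cutswap T i * cutswap (sw T i) j *: v (sw (sw T i) j).
  rewrite (swap_comm T far); set U := sw (sw T j) i.
  have [sU|nU] := boolP (std U); last by rewrite (tabvec_nonstd _ nU) !scaler0.
  have Ui : U = sw (sw T i) j by rewrite /U swap_comm.
  have si : std (sw T i).
    rewrite std_swap //.
    apply: (std_unaligned lam_part sT sU (i' := snd_ent i) (j' := fst_ent i)) => //;
      by rewrite /U !tab_swapE ?swap_fst ?swap_snd swap_out //=; lia.
  have sj : std (sw T j).
    rewrite std_swap //.
    apply: (std_unaligned lam_part sT sU (i' := snd_ent j) (j' := fst_ent j)) => //;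
      by rewrite Ui !tab_swapE ?swap_fst ?swap_snd swap_out //=; lia.
  by rewrite /cutswap sT si sj -/U -Ui sU /= swpi swpj mulrC.
apply: (commute_lin (g_opE i T) (g_opE j T) _ _ cc); rewrite g_opE ?eqi ?eqj //.
Qed.

(** All coefficients on the six tableaux permuting [a], [b], [c] come from the labels [x], [y], [z]
    of these entries in [T], which reduces the relation to [braid_lin]. *)
Lemma g_op_braid i j : j = i.+1 :> nat ->
  forall T, std T -> g_op i (g_op j (g_op i (v T))) = g_op j (g_op i (g_op j (v T))).
Proof.
move=> ji T sT.
have ej : fst_ent j = snd_ent i by apply: val_inj.
pose a := fst_ent i; pose b := snd_ent i; pose c := snd_ent j.
have ia : s_ i a = b by apply: swap_fst.
have ib : s_ i b = a by apply: swap_snd.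
have jb : s_ j b = c by rewrite /b -ej; apply: swap_fst.
have jc : s_ j c = b by rewrite /b -ej; apply: swap_snd.
have ic : s_ i c = c by apply: swap_out => /=; lia.
have ja : s_ j a = a by apply: swap_out => /=; lia.
have out k : k != a -> k != b -> k != c -> s_ i k = k /\ s_ j k = k.
  rewrite -!val_eqE /= => h1 h2 h3; split; apply: swap_out => //; lia.
pose x := label T a; pose y := label T b; pose z := label T c.
have gxy : generic x y by apply: (label_generic lam_part) => //=; rewrite -?val_eqE /=; lia.
have gyz : generic y z by apply: (label_generic lam_part) => //=; rewrite -?val_eqE /=; lia.
have gxz : generic x z by apply: (label_generic lam_part) => //=; rewrite -?val_eqE /=; lia.
pose T1 := sw T i; pose T2 := sw T j; pose T12 := sw T1 j; pose T21 := sw T2 i.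
pose T0 := sw T12 i.
have T0E : T0 = sw T21 j.
  apply/ffunP=> k; rewrite !tab_swapE; congr (T _).
  have [->|na] := eqVneq k a; first by rewrite !(ia, ib, ic, ja, jb, jc).
  have [->|nb] := eqVneq k b; first by rewrite !(ia, ib, ic, ja, jb, jc).
  have [->|nc] := eqVneq k c; first by rewrite !(ia, ib, ic, ja, jb, jc).
  by have [e1 e2] := out k na nb nc; rewrite !(e1, e2).
have st :
  (stay T i = stay_coef q x y) * (stay T j = stay_coef q y z) *
  (stay T1 i = stay_coef q y x) * (stay T1 j = stay_coef q x z) *
  (stay T2 i = stay_coef q x z) * (stay T2 j = stay_coef q z y) *
  (stay T12 i = stay_coef q y z) * (stay T21 j = stay_coef q x y).
  by rewrite /stay ej -/a -/b -/c !label_swap !(ia, ib, ic, ja, jb, jc).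
have sw1 := cutswap_mul i sT; rewrite -/a -/b -/x -/y -/T1 in sw1.
have sw2 := cutswap_mul j sT; rewrite ej -/b -/c -/y -/z -/T2 in sw2.
have w0 : cutswap T i * cutswap T1 j * cutswap T12 i *: v T0
        = cutswap T j * cutswap T2 i * cutswap T21 j *: v T0.
  have [s0|n0] := boolP (std T0); last by rewrite (tabvec_nonstd _ n0) !scaler0.
  (* T and T0 order the three entries in opposite ways, so no two of them are
     aligned and all the intermediate tableaux are standard. *)
  have T0a : T0 a = T c by rewrite !tab_swapE !(ia, ib, ic, ja, jb, jc).
  have T0b : T0 b = T b by rewrite !tab_swapE !(ia, ib, ic, ja, jb, jc).
  have T0c : T0 c = T a by rewrite !tab_swapE !(ia, ib, ic, ja, jb, jc).
  have ab : ~~ aligned (T a) (T b).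
    by apply: (std_unaligned lam_part sT s0 _ _ T0c T0b) => /=; lia.
  have bc : ~~ aligned (T b) (T c).
    by apply: (std_unaligned lam_part sT s0 _ _ T0b T0a) => /=; lia.
  have ac : ~~ aligned (T a) (T c).
    by apply: (std_unaligned lam_part sT s0 _ _ T0c T0a) => /=; lia.
  have sT1 : std T1 by rewrite std_swap.
  have sT2 : std T2 by rewrite std_swap // ej.
  have sT12 : std T12.
    by rewrite std_swap // ej !tab_swapE -/b -/c !(ia, ib, ic, ja, jb, jc).
  have sT21 : std T21.
    by rewrite std_swap // !tab_swapE -/a -/b !(ia, ib, ic, ja, jb, jc).
  congr (_ *: _); rewrite /cutswap -/T1 -/T2 -/T12 -/T21 -/T0 -T0E.
  rewrite sT s0 sT1 sT2 sT12 sT21 /= /swap ej -/a -/b -/c !label_swap.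
  by rewrite !(ia, ib, ic, ja, jb, jc); ring.
have e1 := stay_coef_braid1 qX_inj gxy gyz gxz.
have e2 := stay_coef_braid2 qX_inj gxy gyz gxz.
have e3 := stay_coef_braid3 qX_inj gxy gyz gxz.
have hT1 : g_op i (v T1) = stay T1 i *: v T1 + cutswap T1 i *: v T.
  by rewrite g_opE tab_swapK.
have hT2 : g_op j (v T2) = stay T2 j *: v T2 + cutswap T2 j *: v T.
  by rewrite g_opE tab_swapK.
have hT21 : g_op j (v T21) = stay T21 j *: v T21 + cutswap T21 j *: v T0.
  by rewrite g_opE T0E.
apply: (braid_lin (g_opE i T) (g_opE j T) hT1 (g_opE j T1) (g_opE i T2) hT2
  (g_opE i T12) hT21); rewrite ?st ?sw1 ?sw2 //.
Qed.

Lemma g_op_quad i T : std T -> g_op i (g_op i (v T)) = q *: v T +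
  ((q - 1) * (node_comp (T (fst_ent i)) == node_comp (T (snd_ent i)))%:R)
    *: g_op i (v T).
Proof.
move=> sT; have gen := label_generic_adj lam_part (i := i) sT.
apply: (quad_lin (g_opE i T)).
- by rewrite g_opE tab_swapK.
- by rewrite stay_swap stay_coef_add.
- by rewrite cutswap_mul // swap_coef_mul.
Qed.

(** A nonzero stay coefficient puts i and i+1 in one component, so t_a and t_{s_i(a)} have the same
    eigenvalue there. *)
Lemma t_g_op a i T : t_op a (g_op i (v T)) = g_op i (t_op (s_ i a) (v T)).
Proof.
rewrite g_opE lfun_comb !t_opE lfun_scale g_opE scalerDr !scalerA tab_swapE.
rewrite [cutswap T i * _]mulrC; congr (_ *: _ + _ *: _); rewrite /stay /stay_coef /=.
case: eqP => [e|_]; last by rewrite mulr0 mul0r.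
rewrite mulrC; congr (zeta _ * _).
by rewrite /s_; case: tpermP => [->|->|].
Qed.

(** * Invariant subspaces and irreducibility *)

Section Invariant.
Variable W : {vspace V}.
Hypotheses (g_opW : forall i, (g_op i @: W <= W)%VS).
Hypotheses (t_opW : forall a, (t_op a @: W <= W)%VS).

(* The Jucys-Murphy elements J_1 = 1, J_{i+1} = q^-1 g_i J_i g_i act          *)
(* diagonally by the contents.                                                *)
Lemma content_op (a : 'I_n) : exists2 D : 'End(V), (D @: W <= W)%VS &
  forall T, D (v T) = q ^ content (T a) *: v T.
Proof.
case: a; elim=> [|m IHm] lt_m.
  exists \1%VF => [|T]; first by rewrite lim1g.
  rewrite id_lfunE; have [sT|nT] := boolP (std T); last first.
    by rewrite (tabvec_nonstd _ nT) scaler0.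
  by rewrite /content; have [-> ->] := std_first lam_part sT (i := Ordinal lt_m) erefl;
    rewrite subrr expr0z scale1r.
have [D DW DE] := IHm (ltnW lt_m).
have lt_m1 : (m < n.-1)%N by lia.
pose i : 'I_n.-1 := Ordinal lt_m1.
have ei : fst_ent i = Ordinal (ltnW lt_m) by apply: val_inj.
have ei' : snd_ent i = Ordinal lt_m by apply: val_inj.
exists (q^-1 *: (g_op i \o D \o g_op i))%VF => [|T].
  apply/subvP => _ /memv_imgP[w wW ->]; rewrite scale_lfunE memvZ // !comp_lfunE.
  by do !apply: memv_stable => //.
have [sT|nT] := boolP (std T); last first.
  by rewrite (tabvec_nonstd _ nT) linear0 scaler0.
have gen := label_generic_adj lam_part (i := i) sT.
apply: (jucys_murphy_lin q_neq0 (g_opE i T) _ (DE T) _).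
- by rewrite g_opE tab_swapK.
- by rewrite DE tab_swapE -ei swap_fst ei'.
- by rewrite cutswap_mul // -ei -ei'; apply: stay_coef_content2 gen.
- by rewrite stay_swap -ei -ei'; apply: stay_coef_content gen.
Qed.

(** By [std_determined] the tableaux differ in the component or the content of some entry [a], which
    is read off by [t_op a] or by the operator of [content_op]. *)
Lemma separating_op S T : injective zeta -> std S -> std T -> S != T ->
  exists (D : 'End(V)) ev, [/\ (D @: W <= W)%VS,
    forall U, D (v U) = ev U *: v U & ev S != ev T].
Proof.
move=> zeta_inj sS sT.
have [/forallP eq_k|] :=
    boolP [forall a, node_comp (S a) == node_comp (T a)]; last first.
  rewrite negb_forall => /existsP[a ne] _.
  exists (t_op a), (fun U => zeta (node_comp (U a))); split=> // [U|].
    exact: t_opE.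
  by rewrite (inj_eq zeta_inj).
have [/forallP eq_c|] :=
    boolP [forall a, content (S a) == content (T a)]; last first.
  rewrite negb_forall => /existsP[a ne] _; have [D DW DE] := content_op a.
  exists D, (fun U => q ^ content (U a)); split=> //.
  by rewrite (inj_eq qX_inj).
case/eqP; apply: (std_determined lam_part sS sT) => a.
  by apply/eqP.
by apply/eqP.
Qed.

(** Induction on the size of the support of a vector of [W]: while two coordinates are nonzero, a
    separating operator minus one of its eigenvalues removes one and keeps the other. *)
Lemma invariant_tabvec : injective zeta -> W != 0%VS ->
  exists2 T, std T & v T \in W.
Proof.
move=> zeta_inj; rewrite -subv0 => /subvPn[w wW]; rewrite memv0.
have [m] := ubnP #|[set S | (w S : K) != 0]|.
elim: m w wW => // m IHm w wW; rewrite ltnS => le_m w0.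
have [S wS] : exists S, (w S : K) != 0.
  apply/existsP; apply: contraNT w0; rewrite negb_exists => /forallP z.
  by apply/eqP/ffunP=> S; rewrite ffunE; apply/eqP; move: (z S); rewrite negbK.
have [/existsP[T /andP[neTS wT]]|] := boolP [exists T, (T != S) && ((w T : K) != 0)].
  have neST : val S != val T by rewrite (inj_eq val_inj) eq_sym.
  have [D [ev [DW DE ne]]] := separating_op zeta_inj (valP S) (valP T) neST.
  pose w' := D w - ev (val S) *: w.
  have w'E (U : stdtab n lam) : (w' U : K) = (ev (val U) - ev (val S)) * (w U : K).
    by rewrite !ffunE (diag_coord _ _ DE) mulrBl.
  apply: (IHm w').
  - by rewrite rpredB ?memv_stable ?rpredZ.
  - apply: leq_trans le_m; apply/proper_card/properP; split.
      by apply/subsetP=> U; rewrite !inE w'E mulf_eq0 negb_or => /andP[].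
    by exists S; rewrite !inE ?w'E ?subrr ?mul0r ?eqxx.
  - apply/eqP => /ffunP/(_ T) /eqP.
    rewrite [(0 : V) T]ffunE -[_ == _]/((w' T : K) == 0) w'E mulf_eq0 subr_eq0.
    by rewrite (negPf wT) orbF eq_sym (negPf ne).
rewrite negb_exists => /forallP z; exists (val S); first exact: (valP S).
have e : w = (w S : K) *: v (val S).
  rewrite {1}(tabmod_coord w) (bigD1 S) //= big1 ?addr0 // => T ne.
  by have := z T; rewrite ne /= negbK => /eqP ->; rewrite scale0r.
by rewrite -[v _](scalerK wS) -e rpredZ.
Qed.

(** Admissible swaps have nonzero coefficients, so membership of v_T in [W] spreads to all standard
    tableaux by [std_connected]. *)
Lemma invariant_trivial : injective zeta -> W = 0%VS \/ W = fullv.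
Proof.
move=> zeta_inj; have [->|W0] := eqVneq W 0%VS; [by left | right].
have [T sT vT] := invariant_tabvec zeta_inj W0.
apply/eqP; rewrite eqEsubv subvf /=; apply/subvP=> w _.
rewrite (tabmod_coord w); apply: rpred_sum => S _; apply: rpredZ.
apply: (std_connected lam_part sT (valP S) (P := fun U => v U \in W) _ vT) => U i sU sUi vU.
have : swap U i *: v (sw U i) \in W.
  have := memv_stable (g_opW i) vU; rewrite g_opE /cutswap sU sUi /=.
  by rewrite rpredDl // rpredZ.
move=> h; suff ne : swap U i != 0 by rewrite -[v _](scalerK ne) rpredZ.
rewrite swap_eq0 //; apply: contraL sUi => /andP[/eqP eq_k /eqP eq_c].
by rewrite std_swap // negbK (aligned_content lam_part sU eq_k) eq_c addrK eqxx orbT.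
Qed.
End Invariant.
End SeminormalForm.

(** * The action of g_{1,2} *)

Section Symmetrizer.
Variables (K : fieldType) (V : vectType K) (g h : 'End(V)).

Definition symmetrizer (w : V) : V :=
  w + g w + h w + g (h w) + h (g w) + g (h (g w)).

(** The symmetrizer factors as (1 + h + gh)(1 + g), and 1 + g kills [v]. *)
Lemma symmetrizer_sign v : g v = - v -> symmetrizer v = 0.
Proof.
move=> gv; rewrite /symmetrizer gv !linearN /= subrr add0r.
by rewrite addrAC addrK subrr.
Qed.

(** The scalar 1 + 2p + 2p^2 + p^3 counts the six permutations of three letters by length. *)
Lemma symmetrizer_index p v : g v = p *: v -> h v = p *: v ->
  symmetrizer v = ((1 + p) * (1 + p + p ^+ 2)) *: v.
Proof.
move=> gv hv; rewrite /symmetrizer gv hv !lfun_scale gv hv !lfun_scale gv !scalerA.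
by rewrite -[X in X + _ + _ + _ + _ + _]scale1r -!scalerDl; congr (_ *: _); ring.
Qed.

(** The symmetrizer is also (1 + g)(1 + h + hg). The right factor sends [v] to (1 + a(1 + p))v + b(1
    + p)u, and 1 + g kills [u]. *)
Lemma symmetrizer_mixed p a b v u : g v = p *: v -> g u = - u ->
  h v = a *: v + b *: u -> 1 + a * (1 + p) = 0 -> symmetrizer v = 0.
Proof.
move=> gv gu hv e; rewrite /symmetrizer gv hv !lfun_scale hv.
rewrite !lfun_comb gv gu -!scaleN1r !scalerDr !scalerA.
rewrite -[X in X + _ + _ + _ + _ + _]scale1r.
rewrite [LHS](AC (1*1*2*2*2*2) ((1*2*3*5*7*9)*(4*6*8*10))) /= -!scalerDl.
rewrite (_ : 1 + _ + _ + _ + _ + _ = (1 + p) * (1 + a * (1 + p))); last by ring.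
by rewrite (_ : b + _ + _ + _ = 0) ?e ?mulr0 ?scale0r ?addr0 //; ring.
Qed.
End Symmetrizer.

Section SymmetrizerAction.
Variables (K : fieldType) (q : K) (d n : nat) (lam : 'I_d -> seq nat).
Hypotheses (lam_part : forall k, is_partition (lam k)).
Hypotheses (q_neq0 : q != 0) (qX_inj : injective (exprz q)).
Implicit Types (T : tableau d n).
Local Notation V := (tabmod K n lam).
Local Notation v := (@tabvec K d n lam).
Local Notation std := (is_standard lam).
Local Notation g := (g_op q lam).

Lemma g_op_aligned i T : std T ->
  aligned (T (fst_ent i)) (T (snd_ent i)) -> g i (v T) = stay q T i *: v T.
Proof.
move=> sT al; rewrite g_opE /cutswap std_swap // al andbF scale0r addr0 //.
Qed.

Lemma g_op_row i T : std T -> node_comp (T (fst_ent i)) = node_comp (T (snd_ent i)) ->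
  content (T (snd_ent i)) = content (T (fst_ent i)) + 1 -> g i (v T) = q *: v T.
Proof.
move=> sT ek ec; rewrite g_op_aligned //; last first.
  by rewrite (aligned_content lam_part sT ek) ec eqxx.
have gen := label_generic_adj lam_part (i := i) sT.
have := generic_sub qX_inj (ek : (label T _).1 = (label T _).1) gen; rewrite /stay /stay_coef /label /= ek eqxx.
rewrite ec [content _ + 1]addrC -(q_mulX q_neq0) => h; congr (_ *: _).
by rewrite -mulrBr mulfK.
Qed.

Lemma g_op_col i T : std T -> node_comp (T (fst_ent i)) = node_comp (T (snd_ent i)) ->
  content (T (fst_ent i)) = content (T (snd_ent i)) + 1 -> g i (v T) = - v T.
Proof.
move=> sT ek ec; rewrite g_op_aligned //; last first.
  by rewrite (aligned_content lam_part sT ek) ec addrK eqxx orbT.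
have gen := label_generic_adj lam_part (i := i) sT.
have := generic_sub qX_inj (ek : (label T _).1 = (label T _).1) gen; rewrite /stay /stay_coef /label /= ek eqxx.
rewrite ec [content _ + 1]addrC -(q_mulX q_neq0) => h.
by rewrite -[q * _ - _]opprB mulNr divff // scaleN1r.
Qed.

Lemma q_expn_neq1 m : (0 < m)%N -> q ^+ m != 1.
Proof.
by move=> m0; apply/eqP => /(qX_inj (x1 := m%:Z) (x2 := 0)) [e]; rewrite e in m0.
Qed.

(** The factors divide q^2 - 1 and q^3 - 1, which are nonzero by [q_expn_neq1]. *)
Lemma symmetrizer_weight_neq0 : (1 + q) * (1 + q + q ^+ 2) != 0.
Proof.
rewrite mulf_neq0 //; apply/eqP => e.
  have /eqP := @q_expn_neq1 2 isT; apply; apply/eqP; rewrite -subr_eq0.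
  by rewrite (_ : _ - _ = (q - 1) * (1 + q)); [rewrite e mulr0 | ring].
have /eqP := @q_expn_neq1 3 isT; apply; apply/eqP; rewrite -subr_eq0.
by rewrite (_ : _ - _ = (q - 1) * (1 + q + q ^+ 2)); [rewrite e mulr0 | ring].
Qed.

Section Adjacent.
Variables i j : 'I_n.-1.
Hypotheses (i0 : i = 0%N :> nat) (j1 : j = 1%N :> nat).

Lemma fst_ent1 : fst_ent j = snd_ent i.
Proof. by apply: val_inj; rewrite /= i0 j1. Qed.

(** If 2 is below 1, then g_1 acts by -1. Otherwise 3 is below 1, and T and T^{s_2} restrict to the
    two standard tableaux of shape (2,1), which is the case of [symmetrizer_mixed]. *)
Lemma symmetrizer_two_columns T : std T ->
  node_comp (T (fst_ent i)) = node_comp (T (snd_ent i)) ->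
  node_comp (T (snd_ent i)) = node_comp (T (snd_ent j)) ->
  (ncols (lam (node_comp (T (fst_ent i)))) <= 2)%N ->
  symmetrizer (g i) (g j) (v T) = 0.
Proof.
move=> sT eab ebc two.
have [||| ca cbc] := two_columns_first_entries lam_part sT _ _ _ eab ebc two.
- by rewrite /= i0.
- by rewrite /= i0.
- by rewrite /= j1.
case: cbc => [cb|[cb cc]].
  by apply/symmetrizer_sign/g_op_col => //; rewrite ca cb addNr.
have sU : std (permute_tab T (s_ j)).
  rewrite std_swap // (aligned_content lam_part sT) ?fst_ent1 //.
  by rewrite cb cc.
have sjs : s_ j (snd_ent i) = snd_ent j by rewrite -fst_ent1 swap_fst.
have sjf : s_ j (fst_ent i) = fst_ent i by apply: swap_out; rewrite /= i0 j1.
have gU : g i (v (permute_tab T (s_ j))) = - v (permute_tab T (s_ j)).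
  by apply: g_op_col => //; rewrite !tab_swapE sjs sjf ?eab // ca cc addNr.
apply: (symmetrizer_mixed (p := q) _ gU (g_opE q lam j T)).
  by apply: g_op_row => //; rewrite ca cb.
(* Contents 1 and -1 give the stay coefficient -1/(1 + q). *)
rewrite /stay /stay_coef /label /= fst_ent1 ebc eqxx cb cc expr1z exprN1.
have /eqP q2 := @q_expn_neq1 2 isT.
have h : q^-1 - q != 0.
  apply/eqP => e; apply: q2; apply/eqP; rewrite -subr_eq0.
  by rewrite (_ : _ - _ = - q * (q^-1 - q)); [rewrite e mulr0 | field].
have h2 : 1 - q ^+ 2 != 0 by apply/eqP => e; apply: q2; apply/eqP; rewrite eq_sym -subr_eq0 e.
by field; rewrite q_neq0 mulNr -expr2 h2.
Qed.

Lemma symmetrizer_row T : std T ->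
  node_comp (T (fst_ent i)) = node_comp (T (snd_ent i)) ->
  node_comp (T (snd_ent i)) = node_comp (T (snd_ent j)) ->
  content (T (snd_ent i)) = content (T (fst_ent i)) + 1 ->
  content (T (snd_ent j)) = content (T (snd_ent i)) + 1 ->
  symmetrizer (g i) (g j) (v T) = ((1 + q) * (1 + q + q ^+ 2)) *: v T.
Proof.
by move=> sT eab ebc cab cbc; apply: symmetrizer_index; apply: g_op_row;
  rewrite ?fst_ent1.
Qed.
End Adjacent.
End SymmetrizerAction.

(** * Relations in the endomorphism ring *)

Lemma sum_root_of_unity (K : fieldType) (d : nat) (z : K) :
  z ^+ d = 1 -> \sum_(s < d) z ^+ s = d%:R * (z == 1)%:R.
Proof.
move=> zd; have [->|nz] := eqVneq z 1.
  rewrite mulr1 (eq_bigr (fun=> 1)) => [|s _]; last by rewrite expr1n.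
  by rewrite sumr_const card_ord.
have z1 : z - 1 != 0 by rewrite subr_eq0.
by apply: (mulfI z1); rewrite -subrX1 zd subrr !mulr0.
Qed.

Section EndRing.
Variables (K : fieldType) (V : vectType K).
Hypothesis dimV : (0 < dim V)%N.

(** Positive dimension ensures 1 != 0 in the endomorphism ring. *)
Definition endring : nzRingType := lfun_comp_nzRingType dimV.
Local Notation E := endring.

Definition endact (x : E) (w : V) : V := (x : 'End(V)) w.

Lemma endactM (x y : E) w : endact (x * y) w = endact x (endact y w).
Proof. exact: comp_lfunE. Qed.

Lemma endactD (x y : E) w : endact (x + y) w = endact x w + endact y w.
Proof. exact: add_lfunE. Qed.

Lemma endact1 w : endact 1 w = w.
Proof. exact: id_lfunE. Qed.

Lemma endact_sum I (r : seq I) (P : pred I) (F : I -> E) w :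
  endact (\sum_(i <- r | P i) F i) w = \sum_(i <- r | P i) endact (F i) w.
Proof. exact: sum_lfunE. Qed.

Lemma endactZ (x : E) (a : K) w : endact x (a *: w) = a *: endact x w.
Proof. exact: lfun_scale. Qed.

Lemma endact_comb (x : E) (a b : K) (u w : V) :
  endact x (a *: u + b *: w) = a *: endact x u + b *: endact x w.
Proof. exact: lfun_comb. Qed.

Lemma endactX (x : E) (a : K) w k :
  endact x w = a *: w -> endact (x ^+ k) w = a ^+ k *: w.
Proof.
move=> xw; elim: k => [|k IHk]; first by rewrite !expr0 endact1 scale1r.
by rewrite exprSr endactM xw endactZ IHk scalerA -exprS.
Qed.

Definition scalar_op (a : K) : E := a *: \1%VF.

Lemma scalar_opE a w : endact (scalar_op a) w = a *: w.
Proof. by rewrite /endact scale_lfunE id_lfunE. Qed.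

Lemma eq_endact (x y : E) : endact x =1 endact y -> x = y.
Proof. by move=> h; apply/lfunP. Qed.

Lemma scalar_opC a (x : E) : scalar_op a * x = x * scalar_op a.
Proof. by apply: eq_endact => w; rewrite !endactM !scalar_opE endactZ. Qed.

Fact scalar_op_additive : zmod_morphism scalar_op.
Proof. by move=> a b; rewrite /scalar_op scalerBl. Qed.
Fact scalar_op_monoid : monoid_morphism scalar_op.
Proof.
split=> [|a b]; apply: eq_endact => w; rewrite ?endactM !scalar_opE.
  by rewrite scale1r endact1.
by rewrite scalerA.
Qed.
HB.instance Definition _ :=
  GRing.isZmodMorphism.Build K E scalar_op scalar_op_additive.
HB.instance Definition _ :=
  GRing.isMonoidMorphism.Build K E scalar_op scalar_op_monoid.
End EndRing.

Section SeminormalRing.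
Variables (K : fieldType) (q : K) (d n : nat) (lam : 'I_d -> seq nat).
Variables (zeta : 'I_d -> K) (k0 : 'I_d).
Hypotheses (lam_part : forall k, is_partition (lam k)).
Hypotheses (q_neq0 : q != 0) (qX_inj : injective (exprz q)).
Hypotheses (zeta_inj : injective zeta) (zetaX : forall k, zeta k ^+ d = 1).
Hypotheses (zeta0 : zeta k0 = 1) (d_neq0 : d%:R != 0 :> K).
Implicit Types (T : tableau d n) (i j : 'I_n.-1) (a b : 'I_n).
Local Notation V := (tabmod K n lam).
Local Notation v := (@tabvec K d n lam).
Local Notation std := (is_standard lam).
Hypothesis dimV : (0 < dim V)%N.
Local Notation E := (endring dimV).
Local Notation scalar_op := (scalar_op dimV).

Definition g_end i : E := g_op q lam i.
Definition t_end a : E := t_op lam zeta a.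

Definition e_end i : E := e_elt d (scalar_op d%:R^-1) t_end i.

Definition T_end a : E := T_elt d (scalar_op d%:R^-1) t_end a.

Definition g12_end i j : E := g12_elt g_end i j.

Lemma t_endE a T : endact (t_end a) (v T) = zeta (node_comp (T a)) *: v T.
Proof. exact: t_opE. Qed.

Lemma zeta_neq0 k : zeta k != 0.
Proof.
apply/eqP => z; have := zetaX k; rewrite z expr0n.
have /negPf -> : d != 0%N by apply: contraNneq d_neq0 => ->.
by move/eqP; rewrite eq_sym oner_eq0.
Qed.

Lemma g_endE i T : endact (g_end i) (v T) =
  stay q T i *: v T + cutswap q lam T i *: v (permute_tab T (s_ i)).
Proof. exact: g_opE. Qed.

(** The average of the powers of a d-th root of unity is 1 at 1 and 0 elsewhere, and [zeta] takes
    the value 1 only at [k0]. *)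
Lemma T_endE a T :
  endact (T_end a) (v T) = (node_comp (T a) == k0)%:R *: v T.
Proof.
rewrite /T_end /T_elt endactM endact_sum.
rewrite (eq_bigr (fun s : 'I_d => zeta (node_comp (T a)) ^+ s *: v T)); last first.
  by move=> s _; apply/endactX/t_endE.
rewrite -scaler_suml scalar_opE scalerA sum_root_of_unity // mulKf //.
by rewrite -zeta0 (inj_eq zeta_inj).
Qed.

Lemma e_endE i T : endact (e_end i) (v T) =
  (node_comp (T (fst_ent i)) == node_comp (T (snd_ent i)))%:R *: v T.
Proof.
rewrite /e_end /e_elt endactM endact_sum.
set z := zeta (node_comp (T (fst_ent i))); set z' := zeta (node_comp (T (snd_ent i))).
have z'0 : z' != 0 by apply: zeta_neq0.
rewrite (eq_bigr (fun s : 'I_d => (z / z') ^+ s *: v T)); last first.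
  move=> s _; rewrite endactM (endactX _ (t_endE _ T)) endactZ.
  rewrite (endactX _ (t_endE _ T)) scalerA -/z -/z' expr_div_n mulrC.
  (* [z' ^+ (d - s)] is inverse to [z' ^+ s] because [z' ^+ d = 1]. *)
  congr (_ * _ *: _); apply: (mulIf (expf_neq0 s z'0)).
  by rewrite mulVf ?expf_neq0 // -exprD subnK ?zetaX // ltnW.
rewrite -scaler_suml scalar_opE scalerA sum_root_of_unity ?mulKf //.
  by rewrite -[1](divff z'0) (inj_eq (mulIf _)) ?invr_neq0 // (inj_eq zeta_inj).
by rewrite expr_div_n !zetaX divr1.
Qed.

Lemma eq_end (x y : E) :
  (forall T, std T -> endact x (v T) = endact y (v T)) -> x = y.
Proof. exact: eq_on_tabvec. Qed.

Lemma g_end_far i j : (i.+1 < j)%N || (j.+1 < i)%N ->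
  g_end i * g_end j = g_end j * g_end i.
Proof. by move=> far; apply: eq_end => T sT; rewrite !endactM; apply: g_op_far. Qed.

Lemma g_end_braid i j : j = i.+1 :> nat ->
  g_end i * g_end j * g_end i = g_end j * g_end i * g_end j.
Proof. by move=> ji; apply: eq_end => T sT; rewrite !endactM; apply: g_op_braid. Qed.

Lemma t_endC a b : t_end a * t_end b = t_end b * t_end a.
Proof.
apply: eq_end => T sT.
by rewrite !endactM !t_endE !endactZ !t_endE !scalerA mulrC.
Qed.

Lemma t_g_end a i : t_end a * g_end i = g_end i * t_end (s_ i a).
Proof. by apply: eq_end => T sT; rewrite !endactM; apply: t_g_op. Qed.

Lemma t_endX a : t_end a ^+ d = 1.
Proof.
apply: eq_end => T sT.
by rewrite (endactX _ (t_endE a T)) zetaX scale1r endact1.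
Qed.

(** Swapping i and i+1 does not change whether they share a component. In the quadratic relation
    this lets e_i act directly on v_T. *)
Lemma e_g_endC i : e_end i * g_end i = g_end i * e_end i.
Proof.
apply: eq_end => T sT; rewrite (endactM (e_end i)) (endactM (g_end i)) e_endE endactZ.
rewrite g_endE endact_comb !e_endE.
by rewrite !tab_swapE swap_fst swap_snd eq_sym scalerDr !scalerA ![_%:R * _]mulrC.
Qed.

Lemma g_end_quad i :
  g_end i ^+ 2 = scalar_op q + scalar_op (q - 1) * e_end i * g_end i.
Proof.
apply: eq_end => T sT; rewrite -mulrA e_g_endC expr2 endactD.
rewrite (endactM (scalar_op _)) !(endactM (g_end i)) !scalar_opE e_endE endactZ scalerA.
exact: g_op_quad.
Qed.

Lemma g12_endE i j w : endact (g12_end i j) w =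
  symmetrizer (g_op q lam i) (g_op q lam j) w.
Proof. by rewrite /g12_end /g12_elt !endactD !endactM endact1. Qed.

Definition in_first T i j :=
  [&& node_comp (T (fst_ent i)) == k0, node_comp (T (snd_ent i)) == k0
    & node_comp (T (snd_ent j)) == k0].

Section Adjacent.
Variables i j : 'I_n.-1.
Hypotheses (i0 : i = 0%N :> nat) (j1 : j = 1%N :> nat).

Let P := T_end (fst_ent i) * e_end i * e_end j.

Lemma proj_endE T : endact P (v T) = (in_first T i j)%:R *: v T.
Proof.
rewrite endactM (endactM (T_end _)) !(e_endE, endactZ) T_endE !scalerA -!natrM !mulnb.
rewrite /in_first (fst_ent1 i0 j1); congr ((nat_of_bool _)%:R *: _).
case: (eqVneq _ k0) => [->|_]; last by rewrite !andbF.
by rewrite andbT eq_sym andbC; case: eqVneq => [->|_].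
Qed.

(** The condition [in_first] is unchanged when the three entries are permuted. *)
Lemma proj_g_endC k : (k == i) || (k == j) -> P * g_end k = g_end k * P.
Proof.
move=> kij; apply: eq_end => T sT; rewrite (endactM P) (endactM (g_end k)) proj_endE endactZ.
rewrite g_endE endact_comb !proj_endE.
rewrite scalerDr !scalerA ![_%:R * _]mulrC; congr (_ + _ *: _); congr (_ * _%:R).
rewrite /in_first !tab_swapE; case/orP: kij => /eqP ->.
  rewrite swap_fst swap_snd [s_ i _]swap_out /= ?i0 ?j1 //.
  by rewrite andbCA.
rewrite -(fst_ent1 i0 j1) swap_fst swap_snd [s_ j _]swap_out /= ?i0 ?j1 //.
by congr andb; rewrite andbC.
Qed.

Lemma proj_g12_end T : endact (P * g12_end i j) (v T) =
  (in_first T i j)%:R *: symmetrizer (g_op q lam i) (g_op q lam j) (v T).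
Proof.
have Pi : GRing.comm P (g_end i) by apply: proj_g_endC; rewrite eqxx.
have Pj : GRing.comm P (g_end j) by apply: proj_g_endC; rewrite eqxx orbT.
have -> : P * g12_end i j = g12_end i j * P.
  by do !(apply: commrD || apply: commrM || apply: commr1 || assumption).
by rewrite endactM proj_endE endactZ g12_endE.
Qed.
End Adjacent.
End SeminormalRing.

(** * The representation over C(q) *)

Section RationalFunctions.
Variable R : realType.
Local Notation q := (Cq_q R).

Lemma exprz_inj (K : fieldType) (x : K) : x != 0 ->
  (forall m, (0 < m)%N -> x ^+ m != 1) -> injective (exprz x).
Proof.
move=> x0 x1 a b e; have : x ^ (a - b) = 1.
  by rewrite expfzDr // e -expfzDr // subrr expr0z.
case eab: (a - b) => [[|m]|m] xm.
- by apply/eqP; rewrite -subr_eq0 eab.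
- by have := x1 m.+1 isT; rewrite exprnP xm eqxx.
- by have := x1 m.+1 isT; rewrite -invr_eq1 -[_^-1]/(x ^ Negz m) xm eqxx.
Qed.

Lemma Cq_qX_inj : injective (exprz q).
Proof.
apply: exprz_inj => [|m m0]; first exact: Cq_q_neq0.
rewrite -tofracXn -tofrac1 tofrac_eq; apply/eqP => /(congr1 (size \o polyseq)) /=.
by rewrite size_polyXn size_poly1 => -[e]; rewrite e in m0.
Qed.

Lemma Cq_const_inj : injective (@Cq_const R).
Proof. by move=> a b /eqP; rewrite tofrac_eq => /eqP/polyC_inj. Qed.

Lemma Cq_constX (c : complex R) k : Cq_const (c ^+ k) = Cq_const c ^+ k.
Proof. by rewrite /Cq_const polyC_exp tofracXn. Qed.

Lemma Cq_const1 : Cq_const (1 : complex R) = 1.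
Proof. by rewrite /Cq_const polyC1 tofrac1. Qed.

Lemma Cq_const_nat k : Cq_const (k%:R : complex R) = k%:R.
Proof. by rewrite /Cq_const polyC_natr rmorph_nat. Qed.

Lemma Cq_natr_neq0 k : (0 < k)%N -> k%:R != 0 :> Cq R.
Proof.
move=> k0; rewrite -Cq_const_nat tofrac_eq0 polyC_eq0 pnatr_eq0.
by rewrite -lt0n.
Qed.

Lemma Cq_const_natV k : (0 < k)%N -> Cq_const (k%:R^-1 : complex R) = k%:R^-1.
Proof.
move=> k0; have nz := Cq_natr_neq0 k0; apply: (mulIf nz).
rewrite mulVf // -Cq_const_nat /Cq_const -tofracM -polyCM mulVf ?tofrac1 //.
by rewrite pnatr_eq0 -lt0n.
Qed.
End RationalFunctions.

Section Representations.
Variables (K : fieldType) (B : algOverType K) (V : vectType K).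
Hypothesis dimV : (0 < dim V)%N.
Local Notation E := (endring dimV).

Lemma repr_alg_morph (rho : repr_of B V) :
  alg_morph (scalar_op dimV) (rho : B -> E).
Proof.
split; [exact: ract1|exact: ractD|exact: ractM|exact: ractZ].
Qed.

Lemma alg_morph_repr (f : B -> E) : alg_morph (scalar_op dimV) f ->
  exists rho : repr_of B V, forall x, rho x = f x.
Proof.
by case=> f1 fD fM fs; exists (ReprOf f1 fD fM fs).
Qed.
End Representations.

(** * Maps out of the Yokonuma-Hecke algebra and its quotient *)

Section YokonumaHeckeMorphisms.
Variables (R : realType) (d n : nat) (E : nzRingType).
Local Notation L := (laurent R).
Local Notation YH := (YH R d n).
Local Notation inv_d := (laurent_const (d%:R^-1 : complex R)).
Variables (s : {rmorphism L -> E}) (g : 'I_n.-1 -> E) (t : 'I_n -> E).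

Local Notation e_image := (e_elt d (s inv_d) t).
Local Notation T_image := (T_elt d (s inv_d) t).
Local Notation g12_image := (g12_elt g).

Section Images.
Variables (B : algOverType L) (f : B -> E) (tB : 'I_n -> B) (gB : 'I_n.-1 -> B).
Hypotheses (fM : alg_morph s f) (fg : forall i, f (gB i) = g i).
Hypothesis ft : forall j, f (tB j) = t j.

Lemma alg_morph_e i : f (e_ d tB i) = e_image i.
Proof.
rewrite (alg_morphM fM) (alg_morph_scal fM) (alg_morph_sum fM).
congr (_ * _); apply: eq_bigr => k _.
by rewrite (alg_morphM fM) !(alg_morphX fM) !ft.
Qed.

Lemma alg_morph_T j : f (T_ d tB j) = T_image j.
Proof.
rewrite (alg_morphM fM) (alg_morph_scal fM) (alg_morph_sum fM).
by congr (_ * _); apply: eq_bigr => k _; rewrite (alg_morphX fM) ft.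
Qed.

Lemma alg_morph_g12 i j : f (g12_ gB i j) = g12_image i j.
Proof. by rewrite !(alg_morphD fM) !(alg_morphM fM) (alg_morph1 fM) !fg. Qed.

Lemma alg_morph_CTL_gen j i1 i2 :
  f (T_ d tB j * e_ d tB i1 * e_ d tB i2 * g12_ gB i1 i2) =
  T_image j * e_image i1 * e_image i2 * g12_image i1 i2.
Proof.
rewrite (alg_morphM fM _ (g12_ _ _ _)) (alg_morphM fM (_ * _)).
by rewrite (alg_morphM fM (T_ d tB j)) alg_morph_T !alg_morph_e alg_morph_g12.
Qed.
End Images.

Lemma YH_lift : (forall a x, s a * x = x * s a) ->
  (forall i j : 'I_n.-1, (i.+1 < j)%N || (j.+1 < i)%N -> g i * g j = g j * g i) ->
  (forall i j : 'I_n.-1, j = i.+1 :> nat -> g i * g j * g i = g j * g i * g j) ->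
  (forall a b, t a * t b = t b * t a) ->
  (forall a i, t a * g i = g i * t (s_ i a)) ->
  (forall a, t a ^+ d = 1) ->
  (forall i, g i ^+ 2 =
     s (laurent_q R) + s (laurent_q R - 1) * e_image i * g i) ->
  exists phi : YH -> E,
  [/\ alg_morph s phi, forall i, phi (YH_g R d i) = g i
    & forall j, phi (YH_t R d j) = t j].
Proof.
move=> sC far braid tt tg td quad.
pose h (x : 'I_n.-1 + 'I_n) : E := match x with inl i => g i | inr j => t j end.
have [F FM Fvar] := freealg_lift h sC.
have [|phi phiM phiE] := quotalg_lift (S := @YH_rel R d n) FM.
  move=> _ [i j ij|i j ij|i j|j i|j|i].
  - by rewrite (alg_morph_comm FM) !Fvar far // subrr.
  - by rewrite (alg_morph_braid FM) !Fvar braid // subrr.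
  - by rewrite (alg_morph_comm FM) !Fvar tt // subrr.
  - by rewrite (alg_morph_comm FM) !Fvar tg // subrr.
  - by rewrite (alg_morph_unipotent FM) !Fvar td // subrr.
  - rewrite (alg_morph_quad FM) !Fvar (alg_morph_e FM (fun j => Fvar (inr j))).
    by rewrite quad // subrr.
by exists phi; split=> // [i|j]; rewrite phiE Fvar.
Qed.

Lemma CTL_lift (phi : YH -> E) : alg_morph s phi ->
  (forall i, phi (YH_g R d i) = g i) -> (forall j, phi (YH_t R d j) = t j) ->
  (forall (j : 'I_n) (i1 i2 : 'I_n.-1), j = 0%N :> nat -> i1 = 0%N :> nat ->
    i2 = 1%N :> nat -> T_image j * e_image i1 * e_image i2 * g12_image i1 i2 = 0) ->
  exists2 psi : CTL R d n -> E, alg_morph s psi &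
    forall x, psi (YH_to_CTL x) = phi x.
Proof.
move=> phiM phig phit gen0; apply: quotalg_lift => // _ [j i1 i2 j0 i10 i21].
by rewrite (alg_morph_CTL_gen phiM phig phit) gen0.
Qed.
End YokonumaHeckeMorphisms.

Section SeminormalRepresentation.
Variables (R : realType) (d n : nat) (xi : 'I_d -> complex R) (k0 : 'I_d).
Variable lam : 'I_d -> seq nat.
Hypotheses (xi_inj : injective xi) (xiX : forall k, xi k ^+ d = 1).
Hypotheses (xi0 : xi k0 = 1) (d_gt0 : (0 < d)%N).
Hypotheses (lam_part : forall k, is_partition (lam k)).
Local Notation K := (Cq R).
Local Notation L := (laurent R).
Local Notation q := (Cq_q R).
Local Notation V := (tabmod K n lam).
Hypothesis dimV : (0 < dim V)%N.
Local Notation E := (endring dimV).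
Local Notation std := (is_standard lam).
Local Notation zeta := (fun k => Cq_const (xi k)).
Local Notation sK := (scalar_op dimV).
Local Notation sL := (sK \o laurent_incl R).
Local Notation G := (g_end q dimV).
Local Notation T := (t_end zeta dimV).
Local Notation YH := (YH R d n).

Lemma t_actionE j (S : tableau d n) : std S ->
  t_action xi lam j S = endact (T j) (tabvec K lam S).
Proof. by move=> sS; rewrite t_endE. Qed.

Lemma g_actionE i (S : tableau d n) : std S ->
  g_action R lam i S = endact (G i) (tabvec K lam S).
Proof.
move=> sS; rewrite /endact tabextE //.
rewrite /g_action /stay /stay_coef /swap /swap_coef /label /p_ /=.
case: ltngtP => [lt|gt|/val_inj e].
- by rewrite -val_eqE /= (gtn_eqF lt) scale0r add0r scale1r.
- by rewrite -val_eqE /= (ltn_eqF gt) scale0r add0r.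
- by rewrite e eqxx.
Qed.

Lemma zeta_facts : [/\ injective zeta, forall k, zeta k ^+ d = 1 & zeta k0 = 1].
Proof.
split=> [a b /Cq_const_inj/xi_inj // | k | ]; last by rewrite xi0 Cq_const1.
by rewrite -Cq_constX xiX Cq_const1.
Qed.

Lemma sL_const : sL (laurent_const (d%:R^-1 : complex R)) = sK d%:R^-1.
Proof. by rewrite /= Cq_const_natV. Qed.

(** Existence of the action on [V_lambda], proved from the relations between the operators, at first
    over the Laurent polynomials only. *)
Lemma YH_seminormal : exists phi : YH -> E,
  [/\ alg_morph sL phi, forall i, phi (YH_g R d i) = G i
    & forall j, phi (YH_t R d j) = T j].
Proof.
have [zeta_inj zetaX zeta0] := zeta_facts.
have dK := Cq_natr_neq0 R d_gt0.
have q0 := Cq_q_neq0 R; have qX := @Cq_qX_inj R.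
apply: (YH_lift (s := sL)).
- by move=> a x; apply: scalar_opC.
- by move=> i j; apply: g_end_far.
- by move=> i j; apply: g_end_braid.
- by move=> a b; apply: t_endC.
- by move=> a i; apply: t_g_end.
- by move=> a; apply: t_endX.
- move=> i; have := g_end_quad lam_part q0 qX zeta_inj zetaX dK dimV i.
  by rewrite /e_end -sL_const.
Qed.

Lemma CTL_gen_eq0 (a : 'I_n) (i j : 'I_n.-1) :
  a = 0%N :> nat -> i = 0%N :> nat -> j = 1%N :> nat -> (ncols (lam k0) <= 2)%N ->
  T_end zeta dimV a * e_end zeta dimV i * e_end zeta dimV j
    * g12_end q dimV i j = 0.
Proof.
have [zeta_inj zetaX zeta0] := zeta_facts.
have dK := Cq_natr_neq0 R d_gt0.
have q0 := Cq_q_neq0 R; have qX := @Cq_qX_inj R.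
move=> a0 i0 j1 two; have -> : a = fst_ent i by apply: val_inj; rewrite /= a0 i0.
apply: eq_end => S sS; rewrite (proj_g12_end q zeta_inj zetaX zeta0) //.
rewrite /in_first; case: eqP => [ea|]; last by rewrite scale0r /endact zero_lfunE.
case: eqP => [eb|]; last by rewrite scale0r /endact zero_lfunE.
case: eqP => [ec|]; last by rewrite scale0r /endact zero_lfunE.
rewrite (symmetrizer_two_columns lam_part q0 qX) ?ea ?eb ?ec //.
by rewrite scaler0 /endact zero_lfunE.
Qed.

(** The action kills the generator by [CTL_gen_eq0], hence descends to the quotient, and both
    actions extend to [K]. A subspace stable under [tau] is stable under all the g_i and t_j, so
    [invariant_trivial] applies. *)
Lemma two_columns_irreducible :
  (ncols (lam k0) <= 2)%N -> Vlam_irreducible_CTL n xi lam.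
Proof.
have [zeta_inj zetaX zeta0] := zeta_facts.
have q0 := Cq_q_neq0 R; have qX := @Cq_qX_inj R.
move=> two; have [phi [phiM phig phit]] := YH_seminormal.
have [psi psiM psiE] : exists2 psi : CTL R d n -> E, alg_morph sL psi &
    forall x, psi (YH_to_CTL x) = phi x.
  apply: (CTL_lift phiM phig phit) => a i j a0 i0 j1.
  by have := CTL_gen_eq0 a0 i0 j1 two; rewrite /T_end /e_end -sL_const.
have sC (a : K) (x : E) : sK a * x = x * sK a by apply: scalar_opC.
have [phiK phiKM phiKE] := scalar_ext_lift sC phiM.
have [psiK psiKM psiKE] := scalar_ext_lift sC psiM.
have [rho rhoE] := alg_morph_repr phiKM.
have [tau tauE] := alg_morph_repr psiKM.
exists rho, tau; split.
- move=> S; split=> [j|i].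
    by rewrite rhoE phiKE phit t_actionE ?(valP S).
  by rewrite rhoE phiKE phig g_actionE ?(valP S).
- by move=> x; rewrite rhoE tauE phiKE psiKE psiE.
split.
  by move=> full0; move: dimV; rewrite -dimvf full0 dimv0.
move=> W tauW; apply: (invariant_trivial lam_part q0 qX _ _ zeta_inj).
- by move=> i; have := tauW (CTL_in (YH_to_CTL (YH_g R d i)));
    rewrite tauE psiKE psiE phig.
- by move=> a; have := tauW (CTL_in (YH_to_CTL (YH_t R d a)));
    rewrite tauE psiKE psiE phit.
Qed.

(** The generator is 0 in the quotient, so it acts by 0 on any pullback; on the row reading tableau
    of a shape with three columns it would act by a nonzero scalar. *)
Lemma irreducible_two_columns : (\sum_(k < d) sumn (lam k))%N = n -> k0 = 0%N :> nat ->
  Vlam_irreducible_CTL n xi lam -> (ncols (lam k0) <= 2)%N.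
Proof.
have [zeta_inj zetaX zeta0] := zeta_facts.
have dK := Cq_natr_neq0 R d_gt0.
have q0 := Cq_q_neq0 R; have qX := @Cq_qX_inj R.
move=> lam_sum k00 [rho [tau [rhoV rho_tau _]]].
rewrite leqNgt ncols_nth0 //; apply/negP => three.
have n3 : (2 < n)%N.
  have le_n : (sumn (lam k0) <= n)%N by rewrite -lam_sum (bigD1 k0) //= leq_addr.
  exact: leq_trans (leq_trans three (nth_sumn _ _)) le_n.
have lt0 : (0 < n.-1)%N by lia.
have lt1 : (1 < n.-1)%N by lia.
pose i : 'I_n.-1 := Ordinal lt0; pose j : 'I_n.-1 := Ordinal lt1.
pose a : 'I_n := fst_ent i.
have [S sS rS] := reading_tableau lam_part lam_sum (k0, a, a).
have [[ka kb kc] [ca cb cc]] := three_columns_first_entries (a := fst_ent i)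
  (b := snd_ent i) (c := snd_ent j) sS rS k00 three erefl erefl erefl.
pose phi (x : YH) : E := rho (YH_in x).
have phiM : alg_morph sL phi := alg_morph_ext_in (repr_alg_morph dimV rho).
(* [is_Vlam] fixes the generators on a basis, so [rho] is given by the seminormal operators. *)
have phig k : phi (YH_g R d k) = G k.
  apply: eq_end => U sU; have [_ gU] := rhoV (Sub U sU).
  by have := gU k; rewrite SubK g_actionE.
have phit b : phi (YH_t R d b) = T b.
  apply: eq_end => U sU; have [tU _] := rhoV (Sub U sU).
  by have := tU b; rewrite SubK t_actionE.
have tauM := alg_morph_ext_in (repr_alg_morph dimV tau).
have gen0 : phi (T_ d (@YH_t R d n) a * e_ d (@YH_t R d n) i
    * e_ d (@YH_t R d n) j * g12_ (@YH_g R d n) i j) = 0.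
  rewrite /phi rho_tau (_ : YH_to_CTL _ = 0); first exact: (alg_morph0 tauM).
  by apply/qprojP; rewrite subr0; apply: ideal_mem; apply: CTL_gen.
move: gen0; rewrite (alg_morph_CTL_gen d phiM phig phit).
move=> gen0; have := proj_g12_end q zeta_inj zetaX zeta0 dK dimV
  (erefl : i = 0%N :> nat) (erefl : j = 1%N :> nat) S.
rewrite /T_end /e_end -sL_const -/a gen0 /endact zero_lfunE.
rewrite /in_first ka kb kc !eqxx scale1r.
rewrite (symmetrizer_row lam_part q0 qX) ?ka ?kb ?kc ?ca ?cb ?cc //.
move/esym/eqP; rewrite scaler_eq0 (negPf (tabvec_neq0 _ sS)) orbF.
by rewrite (negPf (symmetrizer_weight_neq0 qX)).
Qed.
End SeminormalRepresentation.

Theorem theorem5p3 (R : realType) (d n : nat) (d_gt0 : (0 < d)%N)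
    (n_gt0 : (0 < n)%N)
    (xi : 'I_d -> complex R)
    (xi_inj : injective xi)
    (xi_root : forall z : complex R, (z ^+ d = 1)%R <-> exists k, z = xi k)
    (xi_first : xi (Ordinal d_gt0) = 1%R)
    (lam : 'I_d -> seq nat)
    (lam_dpart : is_dpartition n lam) :
  Vlam_irreducible_CTL n xi lam <-> (ncols (lam (Ordinal d_gt0)) <= 2)%N.
Proof.
have [lam_part lam_sum] := lam_dpart.
have xiX k : xi k ^+ d = 1 by apply/xi_root; exists k.
pose o : 'I_n := Ordinal n_gt0.
have [T sT _] := reading_tableau lam_part lam_sum (Ordinal d_gt0, o, o).
(* A standard tableau exists, so the module is nonzero. *)
have dimV : (0 < dim (tabmod (Cq R) n lam))%N.
  rewrite -dimvf lt0n dimv_eq0; apply/eqP => full0.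
  have := memvf (tabvec (Cq R) lam T); rewrite full0 memv0.
  by rewrite (negPf (tabvec_neq0 _ sT)).
split.
  exact: (irreducible_two_columns xi_inj xiX xi_first d_gt0 lam_part dimV lam_sum).
exact: (two_columns_irreducible xi_inj xiX xi_first d_gt0 lam_part dimV).
Qed.
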